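(* The protocol SQuad, described explicitly in the context (certification phase followed by $\mathrm{Quad}_{cer}$), is a (partially synchronous) Byzantine consensus protocol, i.e. it satisfies validity, agreement and termination among $n=3f+1$ processes of which at most $f$ are Byzantine, with (1) $O(n^2)$ communication complexity, and (2) $O(f)$ latency complexity. (The constants hidden in $O(\cdot)$ do not depend on $n$, $f$ or the execution; $\delta$ is regarded as a constant.)
   Context: Model. There are $n=3f+1$ processes $P_1,\dots,P_n$, $f\ge 1$, at most $f$ of them Byzantine (arbitrary behavior); the others are correct. Processes exchange messages over reliable authenticated point-to-point links. Every execution has a time $\mathit{GST}$, unknown to processes, and there is a known $\delta>0$ such that message delays are bounded by $\delta$ after $\mathit{GST}$. All correct processes start by $\mathit{GST}$. Local clocks may drift arbitrarily before $\mathit{GST}$ and do not drift afterwards. Local steps take zero time; no process takes infinitely many steps in finite time. For $k=2f+1$ and for $k=f+1$ there is an (unforgeable) $(k,n)$-threshold signature scheme: each process can produce partial signatures of a message $m$, and $k$ partial signatures of $m$ by distinct processes can be combined into a single threshold signature of $m$; all signatures can be verified by everyone. Messages with invalid signatures are ignored. ''Broadcast'' means send to all processes, including oneself. Byzantine consensus. Each correct process proposes a value and should decide a value. Validity: if all correct processes propose the same value, then only that value can be decided by a correct process. Agreement: no two correct processes decide different values. Termination: all correct processes eventually decide. Complexity. A word contains a constant number of signatures and values; each message contains at least one word. For an execution $\alpha$, let $t_d(\alpha)$ be the first time by which all correct processes have decided. The communication complexity of $\alpha$ is the number of words sent in messages by all correct processes during $[\mathit{GST},t_d(\alpha)]$ ($0$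 if $\mathit{GST}>t_d(\alpha)$); the latency complexity of $\alpha$ is $\max(0,t_d(\alpha)-\mathit{GST})$. The communication (latency) complexity of a protocol is the maximum over all its executions. View synchronizer RareSync with parameter $\Delta$ (code of $P_i$; uses the $(2f+1,n)$-scheme). Views are $1,2,\dots$; $\mathrm{leader}(v)=P_{(v \bmod n)+1}$. Views are grouped into epochs of $f+1$ consecutive views: the $j$-th view of epoch $e$ is view $(e-1)(f+1)+j$. Let $\mathit{view\_duration}=\Delta+2\delta+\epsilon$ with $\epsilon>0$ a fixed constant. Variables: $\mathit{epoch}_i=1$, $\mathit{view}_i=1$, $\mathit{epoch\_sig}_i=\bot$, and two local timers (view timer, dissemination timer); cancelling a timer removes its pending expirations. (a) At the start: set the view timer to $\mathit{view\_duration}$ and trigger advance(1). (b) When the view timer expires: if $\mathit{view}_i<f+1$, increment $\mathit{view}_i$, set the view timer to $\mathit{view\_duration}$ and trigger advance($(\mathit{epoch}_i-1)(f+1)+\mathit{view}_i$); otherwise broadcast $\langle$EPOCH-COMPLETED, $\mathit{epoch}_i$, partial signature of $\mathit{epoch}_i\rangle$. (c) When, for some $e\ge \mathit{epoch}_i$, EPOCH-COMPLETED messages for $e$ have been received from $2f+1$ processes: let $\mathit{epoch\_sig}_i$ be the combination of their partial signatures, set $\mathit{epoch}_i=e+1$, cancel both timers, and set the dissemination timer to $\delta$. (d) On receiving $\langle$ENTER-EPOCH, $e$, $\mathit{sig}\rangle$ with $e>\mathit{epoch}_i$ and $\mathit{sig}$ a threshold signature of $e-1$: set $\mathit{epoch\_sig}_i=\mathit{sig}$,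 $\mathit{epoch}_i=e$, cancel both timers, and set the dissemination timer to $\delta$. (e) When the dissemination timer expires: broadcast $\langle$ENTER-EPOCH, $\mathit{epoch}_i$, $\mathit{epoch\_sig}_i\rangle$, set $\mathit{view}_i=1$, set the view timer to $\mathit{view\_duration}$ and trigger advance($(\mathit{epoch}_i-1)(f+1)+1$). View core (that of HotStuff; uses the $(2f+1,n)$-scheme). A vote of type $T$ for value $x$ in view $v$ carries a partial signature of $[T,x,v]$; a quorum certificate (QC) of type $T$ with value $x$ and view $v$ is the combination of $2f+1$ such votes. Each process keeps, across views, prepareQC and lockedQC, both initially $\bot$ ($\bot$ counts as having value $\bot$ and a view lower than all views). When told to execute view $v$ with leader $L=\mathrm{leader}(v)$, a process stops sending and accepting messages of the previous view and does the following. Prepare: every process sends VIEW-CHANGE with its prepareQC to $L$. $L$ waits for $2f+1$ VIEW-CHANGE messages of view $v$, lets highQC be the received QC of highest view, and broadcasts PREPARE with value $x$ and highQC, where $x$ is the value of highQC, or $L$'s own proposal if highQC is $\bot$. A process waits for the PREPARE message $(x,qc)$ from $L$; if ($qc=\bot$ or $qc$ has value $x$) and (lockedQC $=\bot$, or lockedQC has value $x$, or the view of $qc$ exceeds that of lockedQC), it sends a vote of type PREPARE for $x$ to $L$. Precommit: $L$ waits for $2f+1$ PREPARE votes (same value), combines them into a QC and broadcasts it in a PRECOMMIT message. On receiving from $L$ a QC of type PREPARE and view $v$, a process sets prepareQC to it and sends $L$ a PRECOMMIT vote for its value. Commit: $L$ waits for $2f+1$ PRECOMMIT votes, combines them into a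 QC and broadcasts it in a COMMIT message. On receiving from $L$ a QC of type PRECOMMIT and view $v$, a process sets lockedQC to it and sends $L$ a COMMIT vote for its value. Decide: $L$ waits for $2f+1$ COMMIT votes, combines them into a QC and broadcasts it in a DECIDE message. On receiving from $L$ a QC of type COMMIT and view $v$, a process decides its value (at most once). Quad. Each process initializes the view core with its proposal and starts RareSync with $\Delta=8\delta$; whenever RareSync triggers advance($v$), the view core starts executing view $v$; when the view core decides a value, Quad decides it. Certification phase (code of $P_i$; uses the $(f+1,n)$-scheme). A certificate is a threshold signature; $\mathrm{verify}(v,\sigma)$ is true iff $\sigma$ is a threshold signature of the predefined string ''any value'' or of $v$. (i) At the start: broadcast $\langle$DISCLOSE, own proposal, partial signature of the proposal$\rangle$. (ii) When DISCLOSE messages for the same value $v$ have been received from $f+1$ processes: combine their partial signatures into a certificate $\sigma_v$, broadcast $\langle$CERTIFICATE, $v,\sigma_v\rangle$, and exit the phase. (iii) When for the first time DISCLOSE messages have been received from $2f+1$ processes and no value was received in DISCLOSE messages from $f+1$ processes: broadcast $\langle$ALLOW-ANY, partial signature of ''any value''$\rangle$. (iv) When ALLOW-ANY messages have been received from $f+1$ processes: combine their partial signatures into a certificate $\sigma_\bot$ (which vouches for any value), broadcast $\langle$CERTIFICATE, $\bot,\sigma_\bot\rangle$, and exit the phase. (v) On receiving $\langle$CERTIFICATE, $v,\sigma_v\rangle$ (possibly $v=\bot$, in which case $\sigma_v$ vouches for any value): broadcast it and exit the phase. SQuad. Each process runs the certification phase with its proposal. On exiting it with a certificate $\sigma_v$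 for a value $v$ (so $\mathrm{verify}(v,\sigma_v)$ is true; if the certificate vouches for any value, $v$ may be, e.g., the process's own proposal), it starts $\mathrm{Quad}_{cer}$ with proposal $(v,\sigma_v)$. $\mathrm{Quad}_{cer}$ is Quad in which every value sent is accompanied by a certificate $\sigma$ with $\mathrm{verify}(\text{value},\sigma)$ true, and correct processes ignore messages containing values not so accompanied. When $\mathrm{Quad}_{cer}$ decides a value, the process decides that value in SQuad. *)

(* Defs.v *)
From HB Require Import structures.
From mathcomp Require Import all_boot all_order all_algebra.
From mathcomp Require Import reals.
From Stdlib Require List.

Set Implicit Arguments.
Unset Strict Implicit.
Unset Printing Implicit Defensive.

Import Order.TTheory GRing.Theory Num.Theory.
Local Open Scope ring_scope.

Inductive vtype := VPrepare | VPrecommit | VCommit.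

Definition vtype_eqb (T T' : vtype) : bool :=
  match T, T' with
  | VPrepare, VPrepare | VPrecommit, VPrecommit | VCommit, VCommit => true
  | _, _ => false
  end.

Lemma vtype_eqbP : Equality.axiom vtype_eqb.
Proof. by case; case; constructor. Qed.

HB.instance Definition _ := hasDecEq.Build vtype vtype_eqbP.

(* The (2f+1,n)- and the (f+1,n)-threshold signature schemes. *)
Inductive scheme := TwoFPlusOne | FPlusOne.

Definition threshold (f : nat) (s : scheme) : nat :=
  (if s is TwoFPlusOne then (2 * f).+1 else f.+1)%N.

Definition nproc (f : nat) : nat := (3 * f).+1%N.

Section Protocol.

Variables (R : realType) (V : Type) (f : nat) (delta eps : R).

Local Notation proc := 'I_(nproc f).

(* [P_1, ..., P_n] are numbered from 0 here, so that the leader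
   [P_((v mod n) + 1)] of view [v] is the process number [v mod n]. *)
Definition leader (v : nat) : proc := inord (v %% nproc f).

(* What gets signed: an epoch number, a vote [T, x, v], a value, and the
   predefined string "any value". *)
Inductive content :=
| CEpoch (e : nat)
| CVote (T : vtype) (x : V) (v : nat)
| CValue (x : V)
| CAny.

(* Signatures are symbolic terms. A signature is valid for a given scheme,
   content (and signer, for partial signatures) when it is the corresponding
   term, so combining enough partial signatures of [m] gives [TSig k m]. That
   such a term cannot be made up is the predicate [unforgeable] below. *)
Record psig := PSig { ps_scheme : scheme; ps_signer : proc; ps_content : content }.
Record tsig := TSig { ts_scheme : scheme; ts_content : content }.

Definition verify (x : V) (c : tsig) : Prop :=
  c = TSig FPlusOne CAny \/ c = TSig FPlusOne (CValue x).

(* A value accompanied by a certificate. Votes sign the bare value. *)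
Record cval := CVal { cv_val : V; cv_cert : tsig }.

Definition certified (x : cval) : Prop := verify (cv_val x) (cv_cert x).

Record qc := QC { qc_type : vtype; qc_view : nat; qc_value : cval; qc_sig : tsig }.

Definition valid_qc (T : vtype) (q : qc) : Prop :=
  [/\ qc_type q = T, certified (qc_value q) &
      qc_sig q = TSig TwoFPlusOne (CVote T (cv_val (qc_value q)) (qc_view q))].

Definition valid_prepareQC (oq : option qc) : Prop :=
  if oq is Some q then valid_qc VPrepare q else True.

(* Orders QCs by view, with bottom below every view. *)
Definition qc_rank (oq : option qc) : nat :=
  if oq is Some q then (qc_view q).+1 else 0.

Definition qc_has_value (oq : option qc) (x : V) : Prop :=
  if oq is Some q then cv_val (qc_value q) = x else False.

Inductive msg :=
| Disclose (x : V) (s : psig)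
| AllowAny (s : psig)
| Certificate (ox : option V) (c : tsig)
| EpochCompleted (e : nat) (s : psig)
| EnterEpoch (e : nat) (os : option tsig)
| ViewChange (v : nat) (oq : option qc)
| Prepare (v : nat) (x : cval) (oq : option qc)
| Vote (T : vtype) (v : nat) (x : cval) (s : psig)
| Precommit (q : qc)
| Commit (q : qc)
| Decide (q : qc).

Definition qc_tsigs (oq : option qc) : seq tsig :=
  if oq is Some q then [:: cv_cert (qc_value q); qc_sig q] else [::].

Definition msg_psigs (m : msg) : seq psig :=
  match m with
  | Disclose _ s | AllowAny s | EpochCompleted _ s | Vote _ _ _ s => [:: s]
  | _ => [::]
  end.

Definition msg_tsigs (m : msg) : seq tsig :=
  match m with
  | Certificate _ c => [:: c]
  | EnterEpoch _ (Some s) => [:: s]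
  | ViewChange _ oq => qc_tsigs oq
  | Prepare _ x oq => cv_cert x :: qc_tsigs oq
  | Vote _ _ x _ => [:: cv_cert x]
  | Precommit q | Commit q | Decide q => qc_tsigs (Some q)
  | _ => [::]
  end.

Definition msg_values (m : msg) : seq V :=
  let qc_values oq := if oq is Some q then [:: cv_val (qc_value q)] else [::] in
  match m with
  | Disclose x _ => [:: x]
  | Certificate (Some x) _ => [:: x]
  | ViewChange _ oq => qc_values oq
  | Prepare _ x oq => cv_val x :: qc_values oq
  | Vote _ _ x _ => [:: cv_val x]
  | Precommit q | Commit q | Decide q => qc_values (Some q)
  | _ => [::]
  end.

(* The number of words of a message, when a word holds [w] signatures and
   values: the number of signatures and values divided by [w], rounded up, and
   at least 1. *)
Definition words (w : nat) (m : msg) : nat :=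
  let k := (size (msg_psigs m) + size (msg_tsigs m) + size (msg_values m))%N in
  maxn 1 ((k + w.-1) %/ w)%N.

(* A timer that is set holds the reading of the local clock at which it
   expires. *)
Record sync_state := Sync {
  epoch : nat;
  view : nat;
  epoch_sig : option tsig;
  view_timer : option R;
  dissemination_timer : option R }.

(* [cur] is the view being executed. In the current view: [prepare_seen] tells
   that the process has dealt with the PREPARE message of the leader, [voted]
   lists the types of the PRECOMMIT and COMMIT votes it has sent; [proposed]
   tells that, as a leader, it has broadcast PREPARE, and [announced] lists the
   types of the QCs it has broadcast. *)
Record core_state := Core {
  proposal : cval;
  prepareQC : option qc;
  lockedQC : option qc;
  cur : nat;
  prepare_seen : bool;
  voted : seq vtype;
  proposed : bool;
  announced : seq vtype;
  decision : option V }.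

(* [quad] is [None] until the process exits the certification phase. [inbox]
   has everything received so far, with the sender: a message received too
   early (e.g. one of a view that the process has not yet entered) stays
   available, and each rule of the protocol tells which messages it uses. *)
Record lstate := LState {
  started : bool;
  inbox : seq (proc * msg);
  allow_any_sent : bool;
  quad : option (sync_state * core_state) }.

Definition init_state : lstate := LState false [::] false None.

Definition received (st : lstate) (q : proc) (m : msg) : Prop :=
  List.In (q, m) (inbox st).

Definition receive (q : proc) (m : msg) (st : lstate) : lstate :=
  LState (started st) ((q, m) :: inbox st) (allow_any_sent st) (quad st).

Definition set_quad (st : lstate) (s : sync_state) (c : core_state) : lstate :=
  LState (started st) (inbox st) (allow_any_sent st) (Some (s, c)).

Definition decided (st : lstate) : option V :=
  if quad st is Some (_, c) then decision c else None.

Definition outputs := seq (proc * msg).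

Definition broadcast (m : msg) : outputs := [seq (q, m) | q <- enum 'I_(nproc f)].

Definition at_least (k : nat) (P : proc -> Prop) : Prop :=
  exists Q : {set proc}, (k <= #|Q|)%N /\ forall q, q \in Q -> P q.

Definition Delta : R := 8%:R * delta.

Definition view_duration : R := Delta + 2%:R * delta + eps.

Definition global_view (e j : nat) : nat := (e.-1 * f.+1 + j)%N.

Definition advance (v : nat) (c : core_state) : core_state :=
  Core (proposal c) (prepareQC c) (lockedQC c) v false [::] false [::] (decision c).

Definition advance_out (v : nat) (c : core_state) : outputs :=
  [:: (leader v, ViewChange v (prepareQC c))].

Definition start_sync (clk : R) : sync_state :=
  Sync 1 1 None (Some (clk + view_duration)) None.

Definition start_core (x : cval) : core_state :=
  advance (global_view 1 1) (Core x None None 0 false [::] false [::] None).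

Definition expired (timer : option R) (clk : R) : Prop :=
  if timer is Some d then d <= clk else False.

(* Here and below, [clk] is the present reading of the local clock of [p]. *)
Inductive sync_step (p : proc) (clk : R) (st : lstate) :
  sync_state * core_state -> outputs -> sync_state * core_state -> Prop :=
| ViewTimer_next s c :
    expired (view_timer s) clk -> (view s < f.+1)%N ->
    let v := global_view (epoch s) (view s).+1 in
    sync_step p clk st (s, c) (advance_out v c)
      (Sync (epoch s) (view s).+1 (epoch_sig s) (Some (clk + view_duration))
         (dissemination_timer s), advance v c)
| ViewTimer_last s c :
    expired (view_timer s) clk -> (f.+1 <= view s)%N ->
    sync_step p clk st (s, c)
      (broadcast (EpochCompleted (epoch s) (PSig TwoFPlusOne p (CEpoch (epoch s)))))
      (Sync (epoch s) (view s) (epoch_sig s) None (dissemination_timer s), c)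
| Epoch_completed s c e :
    (epoch s <= e)%N ->
    at_least (2 * f).+1%N (fun q =>
      received st q (EpochCompleted e (PSig TwoFPlusOne q (CEpoch e)))) ->
    sync_step p clk st (s, c) [::]
      (Sync e.+1 (view s) (Some (TSig TwoFPlusOne (CEpoch e))) None
         (Some (clk + delta)), c)
| Epoch_entered s c e q :
    (epoch s < e)%N ->
    let sg := TSig TwoFPlusOne (CEpoch e.-1) in
    received st q (EnterEpoch e (Some sg)) ->
    sync_step p clk st (s, c) [::]
      (Sync e (view s) (Some sg) None (Some (clk + delta)), c)
| DisseminationTimer s c :
    expired (dissemination_timer s) clk ->
    let v := global_view (epoch s) 1 in
    sync_step p clk st (s, c)
      (broadcast (EnterEpoch (epoch s) (epoch_sig s)) ++ advance_out v c)
      (Sync (epoch s) 1 (epoch_sig s) (Some (clk + view_duration)) None,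
       advance v c).

Definition vote_sig (p : proc) (T : vtype) (x : V) (v : nat) : psig :=
  PSig TwoFPlusOne p (CVote T x v).

Definition vote_out (p : proc) (T : vtype) (v : nat) (x : cval) : outputs :=
  [:: (leader v, Vote T v x (vote_sig p T (cv_val x) v))].

Definition safe (x : V) (oq locked : option qc) : Prop :=
  (oq = None \/ qc_has_value oq x) /\
  [\/ locked = None, qc_has_value locked x | (qc_rank locked < qc_rank oq)%N].

Definition announce (T : vtype) (q : qc) : msg :=
  match T with
  | VPrepare => Precommit q
  | VPrecommit => Commit q
  | VCommit => Decide q
  end.

Inductive core_step (p : proc) (st : lstate) :
  core_state -> outputs -> core_state -> Prop :=
| Leader_prepare c (Q : {set proc}) (qcs : proc -> option qc) (h : proc) :
    p = leader (cur c) -> ~~ proposed c ->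
    ((2 * f).+1 <= #|Q|)%N ->
    (forall q, q \in Q ->
       received st q (ViewChange (cur c) (qcs q)) /\ valid_prepareQC (qcs q)) ->
    h \in Q -> (forall q, q \in Q -> (qc_rank (qcs q) <= qc_rank (qcs h))%N) ->
    let x := if qcs h is Some q then qc_value q else proposal c in
    core_step p st c (broadcast (Prepare (cur c) x (qcs h)))
      (Core (proposal c) (prepareQC c) (lockedQC c) (cur c) (prepare_seen c)
         (voted c) true (announced c) (decision c))
| Replica_prepare c x oq outs :
    ~~ prepare_seen c ->
    received st (leader (cur c)) (Prepare (cur c) x oq) ->
    certified x -> valid_prepareQC oq ->
    (safe (cv_val x) oq (lockedQC c) -> outs = vote_out p VPrepare (cur c) x) ->
    (~ safe (cv_val x) oq (lockedQC c) -> outs = [::]) ->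
    core_step p st c outs
      (Core (proposal c) (prepareQC c) (lockedQC c) (cur c) true
         (voted c) (proposed c) (announced c) (decision c))
(* The certificate put into the QC is that of one of the votes. *)
| Leader_announce c T (x : V) (cert : proc -> tsig) (Q : {set proc}) (h : proc) :
    p = leader (cur c) -> T \notin announced c ->
    ((2 * f).+1 <= #|Q|)%N ->
    (forall q, q \in Q -> verify x (cert q) /\
       received st q (Vote T (cur c) (CVal x (cert q)) (vote_sig q T x (cur c)))) ->
    h \in Q ->
    let q := QC T (cur c) (CVal x (cert h)) (TSig TwoFPlusOne (CVote T x (cur c))) in
    core_step p st c (broadcast (announce T q))
      (Core (proposal c) (prepareQC c) (lockedQC c) (cur c) (prepare_seen c)
         (voted c) (proposed c) (T :: announced c) (decision c))
| Replica_precommit c q :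
    VPrecommit \notin voted c ->
    received st (leader (cur c)) (Precommit q) ->
    valid_qc VPrepare q -> qc_view q = cur c ->
    core_step p st c (vote_out p VPrecommit (cur c) (qc_value q))
      (Core (proposal c) (Some q) (lockedQC c) (cur c) (prepare_seen c)
         (VPrecommit :: voted c) (proposed c) (announced c) (decision c))
| Replica_commit c q :
    VCommit \notin voted c ->
    received st (leader (cur c)) (Commit q) ->
    valid_qc VPrecommit q -> qc_view q = cur c ->
    core_step p st c (vote_out p VCommit (cur c) (qc_value q))
      (Core (proposal c) (prepareQC c) (Some q) (cur c) (prepare_seen c)
         (VCommit :: voted c) (proposed c) (announced c) (decision c))
| Replica_decide c q :
    decision c = None ->
    received st (leader (cur c)) (Decide q) ->
    valid_qc VCommit q -> qc_view q = cur c ->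
    core_step p st c [::]
      (Core (proposal c) (prepareQC c) (lockedQC c) (cur c) (prepare_seen c)
         (voted c) (proposed c) (announced c) (Some (cv_val (qc_value q)))).

Definition disclosed (st : lstate) (x : V) (q : proc) : Prop :=
  received st q (Disclose x (PSig FPlusOne q (CValue x))).

(* [exit_value ox c x]: a process that exits the certification phase with the
   pair [ox], [c] of a CERTIFICATE message may propose [x] to Quad_cer. When the
   certificate is for bottom, the choice of [x] is left open. *)
Definition exit_value (ox : option V) (c : tsig) (x : V) : Prop :=
  match ox with
  | Some y => verify y c /\ x = y
  | None => c = TSig FPlusOne CAny
  end.

(* Exit of the certification phase, which starts Quad_cer at once. *)
Inductive exit_step (clk : R) (st : lstate) (ox : option V) (c : tsig) :
  outputs -> lstate -> Prop :=
| Exit x :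
    exit_value ox c x ->
    let core := start_core (CVal x c) in
    exit_step clk st ox c
      (broadcast (Certificate ox c) ++ advance_out (cur core) core)
      (set_quad st (start_sync clk) core).

Inductive start_step (p : proc) (x : V) (st : lstate) : outputs -> lstate -> Prop :=
| Start :
    ~~ started st ->
    start_step p x st (broadcast (Disclose x (PSig FPlusOne p (CValue x))))
      (LState true (inbox st) (allow_any_sent st) (quad st)).

Inductive local_step (p : proc) (clk : R) (st : lstate) : outputs -> lstate -> Prop :=
| Cert_values x outs st' :
    started st -> quad st = None ->
    at_least f.+1 (disclosed st x) ->
    exit_step clk st (Some x) (TSig FPlusOne (CValue x)) outs st' ->
    local_step p clk st outs st'
| Cert_allow_any :
    started st -> quad st = None -> ~~ allow_any_sent st ->
    at_least (2 * f).+1%N (fun q => exists x, disclosed st x q) ->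
    (forall x, ~ at_least f.+1 (disclosed st x)) ->
    local_step p clk st (broadcast (AllowAny (PSig FPlusOne p CAny)))
      (LState true (inbox st) true None)
| Cert_any outs st' :
    started st -> quad st = None ->
    at_least f.+1 (fun q => received st q (AllowAny (PSig FPlusOne q CAny))) ->
    exit_step clk st None (TSig FPlusOne CAny) outs st' ->
    local_step p clk st outs st'
| Cert_relay q ox c outs st' :
    started st -> quad st = None ->
    received st q (Certificate ox c) ->
    exit_step clk st ox c outs st' ->
    local_step p clk st outs st'
| Quad_sync s c s' c' outs :
    quad st = Some (s, c) ->
    sync_step p clk st (s, c) outs (s', c') ->
    local_step p clk st outs (set_quad st s' c')
| Quad_core s c c' outs :
    quad st = Some (s, c) ->
    core_step p st c outs c' ->
    local_step p clk st outs (set_quad st s c').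

(* [Deliver j k] is the delivery of the [k]-th message sent at step [j]. *)
Inductive event :=
| Idle
| Local (p : proc) (outs : outputs)
| Byzantine (b : proc) (outs : outputs)
| Deliver (j k : nat).

(* Step [i] happens at time [time i], and takes the local states [conf i] to
   [conf i.+1]; the states of Byzantine processes are meaningless. *)
Record run := Run {
  byz : {set proc};
  gst : R;
  clock : proc -> R -> R;
  input : proc -> V;
  time : nat -> R;
  ev : nat -> event;
  conf : nat -> proc -> lstate }.

Definition correct (r : run) (p : proc) : bool := p \notin byz r.

(* Sender, destination and contents of the messages sent at step [i]. *)
Definition sends (r : run) (i : nat) : seq (proc * proc * msg) :=
  match ev r i with
  | Local p outs | Byzantine p outs => [seq (p, o.1, o.2) | o <- outs]
  | _ => [::]
  end.

Definition produced_before (r : run) (i : nat) (s : psig) : Prop :=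
  exists j dst m, [/\ (j < i)%N, List.In (ps_signer s, dst, m) (sends r j) &
                     List.In s (msg_psigs m)].

(* What a Byzantine process can send at step [i]: the partial signatures of
   correct processes in it have already been produced by them, and its threshold
   signatures can be obtained from partial signatures that exist already or that
   Byzantine processes can produce. *)
Definition unforgeable (r : run) (i : nat) (m : msg) : Prop :=
  (forall s, List.In s (msg_psigs m) -> correct r (ps_signer s) ->
     produced_before r i s) /\
  (forall c, List.In c (msg_tsigs m) ->
     at_least (threshold f (ts_scheme c)) (fun q => correct r q ->
       produced_before r i (PSig (ts_scheme c) q (ts_content c)))).

Definition unchanged_except (r : run) (i : nat) (P : pred proc) : Prop :=
  forall q, ~~ P q -> conf r i.+1 q = conf r i q.

Definition valid_step (r : run) (i : nat) : Prop :=
  match ev r i with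
  | Idle => unchanged_except r i pred0
  | Local p outs =>
      [/\ correct r p,
          start_step p (input r p) (conf r i p) outs (conf r i.+1 p) \/
          started (conf r i p) /\
          local_step p (clock r p (time r i)) (conf r i p) outs (conf r i.+1 p) &
          unchanged_except r i (pred1 p)]
  | Byzantine b outs =>
      [/\ ~~ correct r b, forall o, List.In o outs -> unforgeable r i o.2 &
          unchanged_except r i pred0]
  | Deliver j k =>
      exists src dst m,
      [/\ (j < i)%N, onth (sends r j) k = Some (src, dst, m),
          (forall i', (i' < i)%N -> ev r i' <> Deliver j k),
          conf r i.+1 dst = receive src m (conf r i dst) &
          unchanged_except r i (pred1 dst)]
  end.

Record execution := Execution {
  run_of :> run;
  byz_bound : (#|byz run_of| <= f)%N;
  conf0 : forall p, conf run_of 0 p = init_state;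
  time_monotone : forall i, time run_of i <= time run_of i.+1;
  (* finitely many steps in finite time *)
  time_unbounded : forall t, exists i, t < time run_of i;
  steps_valid : forall i, valid_step run_of i;
  clock_monotone : forall p t u, t <= u -> clock run_of p t <= clock run_of p u;
  clock_no_drift : forall p t, gst run_of <= t ->
    clock run_of p t = clock run_of p (gst run_of) + (t - gst run_of);
  start_by_gst : forall p i, correct run_of p -> gst run_of < time run_of i ->
    started (conf run_of i p);
  delivery : forall j k pkt, onth (sends run_of j) k = Some pkt ->
    exists i, ev run_of i = Deliver j k /\
              time run_of i <= Num.max (time run_of j) (gst run_of) + delta;
  (* Local steps take zero time: while time passes, correct processes have no
     step to take, whether triggered by messages or by timers. *)
  zero_time_steps : forall i p u outs st', correct run_of p ->
    time run_of i <= u -> u < time run_of i.+1 ->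
    ~ local_step p (clock run_of p u) (conf run_of i.+1 p) outs st' }.

Definition decides (a : execution) (p : proc) (x : V) : Prop :=
  exists i, decided (conf a i p) = Some x.

Definition validity (a : execution) : Prop :=
  forall x, (forall p, correct a p -> input a p = x) ->
  forall p y, correct a p -> decides a p y -> y = x.

Definition agreement (a : execution) : Prop :=
  forall p q x y, correct a p -> correct a q ->
  decides a p x -> decides a q y -> x = y.

Definition termination (a : execution) : Prop :=
  forall p, correct a p -> exists x, decides a p x.

Definition all_decided_by (a : execution) (t : R) : Prop :=
  forall p, correct a p ->
  exists i x, time a i <= t /\ decided (conf a i.+1 p) = Some x.

Definition decision_time (a : execution) (td : R) : Prop :=
  all_decided_by a td /\ forall t, all_decided_by a t -> td <= t.

(* The least index of a step that happens after [t]. *)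
Definition steps_until (a : execution) (t : R) : nat :=
  ex_minn (time_unbounded a t).

Definition words_sent (w : nat) (a : execution) (i : nat) : nat :=
  (\sum_(pkt <- sends a i | correct a pkt.1.1) words w pkt.2)%N.

(* Words sent by correct processes during [[gst, td]]. *)
Definition communication (w : nat) (a : execution) (td : R) : nat :=
  (\sum_(i < steps_until a td | (gst a <= time a i)%R) words_sent w a i)%N.

Definition latency (a : execution) (td : R) : R := Num.max 0 (td - gst a).

End Protocol.

(* Main.v *)
(* Safety. A signature scheme cannot be forged, so every QC of a view rests on
   [2f+1] votes, any two such sets share a correct process, and a correct process
   votes once per view and type. Hence a view has one value per QC, and a decided
   value stays locked by [f+1] correct processes that veto all others.

   Liveness. Let [e] be the largest epoch of a correct process at GST. Within
   [4 delta] all correct processes reach [e], and after another epoch length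
   some process enters [e + 1]. From the first such time on, ENTER-EPOCH messages
   bring everyone to the first view of [e + 1] within [2 delta] of each other,
   and nobody can leave [e + 1] early since this takes [f+1] correct processes
   that time out in all its views. The views of [e + 1] have [f+1] distinct
   leaders, so one is correct; its view is common to all correct processes for
   [8 delta], the time of a VIEW-CHANGE message and seven further messages, which
   suffices to decide.

   Communication. Up to the decision only epochs [e] and [e + 1] are run in full,
   and a process leads at most one of the [f+1] views of an epoch. So it sends
   [O(n)] messages per epoch; the bound is a potential that every step decreases
   by the number of messages that it sends. *)

Require Import Defs.
From mathcomp Require Import all_boot all_order all_algebra.
From mathcomp Require Import reals boolp.
From mathcomp Require Import zify ring lra.
From Stdlib Require List.

Set Implicit Arguments.
Unset Strict Implicit.
Unset Printing Implicit Defensive.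

Import Order.TTheory GRing.Theory Num.Theory.
Local Open Scope ring_scope.

(** Liveness does not follow a schedule of events. At a time [t] from GST on, [at_time t] is the
    state after all steps up to [t], and since local steps take zero time, no step is enabled in it
    ([quiescent]). So a process that has what it needs by [t] has already acted, as otherwise it
    could act now. This speaks of states only; the messages that must have been sent are read off
    the flags and timers of a state ([history]).

    Clocks follow real time only after GST, but they are monotone before, so a timer set earlier is
    at most its own duration ahead of the present reading and expires within that duration.

    Byzantine messages are constrained only through earlier messages, so the origin of a signature
    is traced by induction on the step index.

    The [eps] in [view_duration] makes the decision strictly precede the end of the good view: the
    fastest process may leave it [10 * delta + eps] after the earliest start, and the slowest enters
    it [2 * delta] after that start. *)

Lemma In_cat (T : Type) (x : T) (s1 s2 : seq T) :
  List.In x (s1 ++ s2) <-> List.In x s1 \/ List.In x s2.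
Proof.
elim: s1 => [|y s1 IH] /=; first by split; [right | case].
by rewrite IH; tauto.
Qed.

Lemma In_map (T U : Type) (g : T -> U) (y : U) (s : seq T) :
  List.In y [seq g x | x <- s] <-> exists x, List.In x s /\ g x = y.
Proof.
elim: s => [|x s IH] /=; first by split; [case | case=> ? []].
rewrite IH; split; first by case=> [<-|[z [zs <-]]]; [exists x | exists z]; auto.
by case=> z [[<-|zs] e]; [left | right; exists z].
Qed.

Lemma In_filter (T : Type) (P : pred T) (x : T) (s : seq T) :
  List.In x [seq y <- s | P y] <-> List.In x s /\ P x.
Proof.
elim: s => [|y s IH] /=; first by split; case.
case: (boolP (P y)) => Py /=; rewrite IH; split; try tauto.
- by case=> [<-|]; tauto.
- by case=> [[<-|xs] Px]; [rewrite Px in Py | ].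
Qed.

Lemma In_mem (T : eqType) (x : T) (s : seq T) : List.In x s <-> x \in s.
Proof.
elim: s => [|y s IH] //=; rewrite in_cons IH eq_sym.
split; first by case=> [->|->]; rewrite ?eqxx ?orbT.
by case/orP => [/eqP|]; tauto.
Qed.

Lemma In_onth (T : Type) (x : T) (s : seq T) :
  List.In x s <-> exists k, onth s k = Some x.
Proof.
elim: s => [|y s IH] /=; first by split=> // -[[|k]].
rewrite IH; split; first by case=> [->|[k kx]]; [exists 0%N | exists k.+1].
by case=> -[|k] /=; [case; left | right; exists k].
Qed.

(** * Executions as steps of single processes *)

Section SQuad.

Variables (R : realType) (V : Type) (f : nat) (delta eps : R).

Local Notation proc := 'I_(nproc f).
Local Notation msg := (msg V f).
Local Notation tsig := (tsig V).
Local Notation content := (content V).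
Local Notation lstate := (lstate R V f).
Local Notation sync_state := (sync_state R V).
Local Notation core_state := (core_state V).
Local Notation outputs := (outputs V f).
Local Notation execution := (execution V f delta eps).
Local Notation view_duration := (view_duration delta eps).
Local Notation gv := (global_view f).

Lemma In_broadcast (q : proc) (m m' : msg) :
  List.In (q, m') (broadcast m) <-> m' = m.
Proof.
rewrite In_map; split; first by case=> ? [_ []].
by move=> ->; exists q; rewrite In_mem mem_enum.
Qed.

Lemma size_broadcast (m : msg) : size (broadcast m) = nproc f.
Proof. by rewrite size_map size_enum_ord. Qed.

Lemma at_least_sub k (P Q : proc -> Prop) :
  (forall q, P q -> Q q) -> at_least k P -> at_least k Q.
Proof. by move=> PQ [A [kA AP]]; exists A; split=> // q /AP/PQ. Qed.

(** Forgets which rule supplied the signature: combining received shares and receiving the signature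
    itself are alike for the provenance argument. *)
Definition learned (st : lstate) (c : tsig) : Prop :=
  at_least (threshold f (ts_scheme c)) (fun q => exists m, received st q m /\
    List.In (PSig (ts_scheme c) q (ts_content c)) (msg_psigs m)) \/
  exists q m, received st q m /\ List.In c (msg_tsigs m).

(* [local_step], [start_step] and deliveries in one relation, with the three
   ways to exit the certification phase merged. [incoming] has the messages in
   transit. *)
Variant pstep (x : V) (p : proc) (clk : R) (incoming : proc -> msg -> Prop)
    (st : lstate) : outputs -> lstate -> Prop :=
| Pidle : pstep x p clk incoming st [::] st
| Preceive q m : incoming q m ->
    pstep x p clk incoming st [::] (receive q m st)
| Pstart : ~~ started st ->
    pstep x p clk incoming st (broadcast (Disclose x (PSig FPlusOne p (CValue x))))
      (LState true (inbox st) (allow_any_sent st) (quad st))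
| Pallow : started st -> quad st = None -> ~~ allow_any_sent st ->
    at_least (2 * f).+1%N (fun q => exists y, disclosed st y q) ->
    (forall y, ~ at_least f.+1 (disclosed st y)) ->
    pstep x p clk incoming st (broadcast (AllowAny (PSig FPlusOne p (CAny V))))
      (LState true (inbox st) true None)
| Pexit ox c y : started st -> quad st = None ->
    learned st c -> exit_value ox c y ->
    let core := start_core f (CVal y c) in
    pstep x p clk incoming st
      (broadcast (Certificate f ox c) ++ advance_out f (cur core) core)
      (set_quad st (start_sync V delta eps clk) core)
| Psync s c s' c' outs : started st -> quad st = Some (s, c) ->
    sync_step delta eps p clk st (s, c) outs (s', c') ->
    pstep x p clk incoming st outs (set_quad st s' c')
| Pcore s c c' outs : started st -> quad st = Some (s, c) ->
    core_step p st c outs c' ->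
    pstep x p clk incoming st outs (set_quad st s c').

Lemma local_pstep x p clk incoming (st st' : lstate) outs : started st ->
  local_step delta eps p clk st outs st' -> pstep x p clk incoming st outs st'.
Proof.
move=> stst; case=> {outs st'}.
- move=> y outs st' _ qN D; case=> z /= [vy ->].
  apply: Pexit => //=; last first.
  left; apply: at_least_sub D => q rq.
  by exists (Disclose y (PSig FPlusOne q (CValue y))); split=> //=; left.
- by move=> *; apply: Pallow.
- move=> outs st' _ qN D [z ev].
  apply: Pexit => //=; left; apply: at_least_sub D => q rq.
  by exists (AllowAny (PSig FPlusOne q (CAny V))); split=> //=; left.
- move=> q ox c outs st' _ qN rc [z ev].
  by apply: Pexit => //=; right; exists q, (Certificate f ox c); split=> //=; left.
- by move=> *; apply: Psync; eauto.
- by move=> *; apply: Pcore; eauto.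
Qed.

Section Steps.

Variable a : execution.

Definition sent (i : nat) (p d : proc) (m : msg) : Prop :=
  exists j, (j < i)%N /\ List.In (p, d, m) (sends a j).

Definition outs_of (i : nat) (p : proc) : outputs :=
  [seq (pkt.1.2, pkt.2) | pkt <- sends a i & pkt.1.1 == p].

Lemma In_sends (i : nat) (p d : proc) m :
  List.In (p, d, m) (sends a i) <-> List.In (d, m) (outs_of i p).
Proof.
rewrite In_map; split.
  by move=> H; exists (p, d, m); rewrite In_filter /= eqxx.
by case=> -[[p' d'] m']; rewrite In_filter /= => -[[H /eqP <-] [<- <-]].
Qed.

Lemma sent_mono (i j : nat) p d m : (i <= j)%N -> sent i p d m -> sent j p d m.
Proof. by move=> ij [k [ki H]]; exists k; split=> //; apply: leq_trans ij. Qed.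

Lemma sentS (i : nat) p d m :
  sent i.+1 p d m <-> sent i p d m \/ List.In (d, m) (outs_of i p).
Proof.
split.
  case=> j [ji H]; move: ji; rewrite ltnS leq_eqVlt => /predU1P[ji|ji].
    by right; apply/In_sends; rewrite -ji.
  by left; exists j.
case; first exact: sent_mono.
by move=> /In_sends H; exists i.
Qed.

Lemma outs_of_map (q p : proc) (outs : outputs) :
  [seq (pkt.1.2, pkt.2) | pkt <- [seq (q, o.1, o.2) | o <- outs] & pkt.1.1 == p]
  = if q == p then outs else [::].
Proof.
elim: outs => [|[d m] outs IH] /=; first by case: ifP.
by case: ifP IH => /= _ ->.
Qed.

(** Steps of other processes and deliveries elsewhere are idle for [p]. Invariants are proved for
    one [pstep] and lifted along the step index by this lemma. *)
Lemma executionP i p : correct a p ->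
  pstep (input a p) p (clock a p (time a i)) (fun q m => sent i q p m)
    (conf a i p) (outs_of i p) (conf a i.+1 p).
Proof.
move=> cp; move: (steps_valid a i); rewrite /valid_step /outs_of /sends.
case: (ev a i) => [|q outs|b outs|j k].
- by move=> H; rewrite H //; apply: Pidle.
- case=> cq H un; rewrite outs_of_map; case: eqP => [qp|/eqP qp]; last first.
    by rewrite un /= 1?eq_sym //; apply: Pidle.
  subst q; case: H => [H|[st H]]; last exact: local_pstep.
  by case: H => nst; apply: Pstart.
- case=> cb _ un; rewrite outs_of_map; case: eqP => [bp|_]; last first.
    by rewrite un //; apply: Pidle.
  by rewrite bp cp in cb.
- move=> [src [dst [m [ji H _ rc un]]]] /=.
  case: (eqVneq p dst) => [pd|pd]; last by rewrite un //; apply: Pidle.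
  subst dst; rewrite rc; apply: Preceive; exists j; split=> //.
  by apply/In_onth; exists k.
Qed.

Lemma pstep_inbox x p clk inc st outs st' q m :
  pstep x p clk inc st outs st' -> received st' q m ->
  received st q m \/ inc q m.
Proof.
case; rewrite /received /=; try by intros; left.
by move=> q' m' iq [[<- <-]|]; auto.
Qed.

Lemma pstep_received x p clk inc st outs st' q m :
  pstep x p clk inc st outs st' -> received st q m -> received st' q m.
Proof. by case; rewrite /received //=; auto. Qed.

Lemma received_sent i p q m : correct a p ->
  received (conf a i p) q m -> sent i q p m.
Proof.
move=> cp; elim: i => [|i IH]; first by rewrite conf0.
move=> /(pstep_inbox (executionP i cp)) [/IH|]; apply: sent_mono; exact: leqnSn.
Qed.

Lemma received_mono i j p q m : correct a p -> (i <= j)%N ->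
  received (conf a i p) q m -> received (conf a j p) q m.
Proof.
move=> cp; elim: j => [|j IH]; first by rewrite leqn0 => /eqP ->.
rewrite leq_eqVlt => /predU1P[-> //|ij] H.
exact: pstep_received (executionP j cp) (IH ij H).
Qed.

Lemma time_mono i j : (i <= j)%N -> time a i <= time a j.
Proof.
elim: j => [|j IH]; first by rewrite leqn0 => /eqP ->.
rewrite leq_eqVlt => /predU1P[-> //|ij].
exact: le_trans (IH ij) (time_monotone a j).
Qed.

Lemma ltn_steps_until i t : (i < steps_until a t)%N = (time a i <= t).
Proof.
rewrite /steps_until; case: ex_minnP => N tN Nmin.
apply/idP/idP => [iN|it]; last first.
  by rewrite ltnNge; apply/negP => /time_mono; lra.
by rewrite leNgt; apply/negP => /Nmin; rewrite leqNgt iN.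
Qed.

Lemma steps_until_mono t u : t <= u -> (steps_until a t <= steps_until a u)%N.
Proof.
move=> tu; rewrite leqNgt ltn_steps_until -ltNge.
by apply/(le_lt_trans tu); rewrite ltNge -ltn_steps_until ltnn.
Qed.

End Steps.

(** * Monotone quantities and local invariants *)

Lemma ltn_global_view e e' j : (0 < e)%N -> (e < e')%N -> (j <= f.+1)%N ->
  (gv e j < gv e' 1)%N.
Proof. by rewrite /global_view; nia. Qed.

(** Within an epoch, dissemination can only end, and after that the view grows or the view timer is
    cleared. The clause [view_timer s <> None] makes the relation transitive: after the view timer
    is cleared, no later view of the same epoch follows. *)
Definition sync_le (s s' : sync_state) : Prop :=
  (epoch s <= epoch s')%N /\
  (epoch s = epoch s' ->
    (dissemination_timer s' = dissemination_timer s \/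
     dissemination_timer s' = None) /\
    (dissemination_timer s = None ->
       (view s < view s')%N /\ view_timer s <> None \/
       view s = view s' /\
       (view_timer s' = view_timer s \/ view_timer s' = None))).

Definition core_le (c c' : core_state) : Prop :=
  [/\ (cur c <= cur c')%N,
      cur c = cur c' ->
        [/\ prepare_seen c -> prepare_seen c', proposed c -> proposed c',
            {subset voted c <= voted c'} & {subset announced c <= announced c'}],
      (qc_rank (prepareQC c) <= qc_rank (prepareQC c'))%N,
      (qc_rank (lockedQC c) <= qc_rank (lockedQC c'))%N &
      decision c <> None -> decision c' = decision c].

(** While the dissemination timer runs, [epoch s] is already the new epoch, but the core still
    executes a view [v] of an older one and [view s] is stale. *)
Definition wf_sync (s : sync_state) (v : nat) : Prop :=
  [/\ (0 < epoch s)%N, (0 < view s <= f.+1)%N,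
      dissemination_timer s = None -> v = gv (epoch s) (view s),
      dissemination_timer s <> None ->
        [/\ view_timer s = None, (v < gv (epoch s) 1)%N & (1 < epoch s)%N] &
      (1 < epoch s)%N ->
        epoch_sig s = Some (TSig TwoFPlusOne (CEpoch V (epoch s).-1))].

(** As [qc_rank] is one more than the view, the first two clauses say that no stored QC is of a view
    above the current one. *)
Definition wf_core (c : core_state) : Prop :=
  [/\ (qc_rank (prepareQC c) <= (cur c).+1)%N,
      (qc_rank (lockedQC c) <= (cur c).+1)%N,
      valid_prepareQC (prepareQC c),
      forall q, lockedQC c = Some q -> valid_qc VPrecommit q &
      certified (proposal c)].

Lemma sync_le_refl s : sync_le s s.
Proof. by split=> // _; split; auto. Qed.

Lemma sync_le_trans s1 s2 s3 : sync_le s1 s2 -> sync_le s2 s3 -> sync_le s1 s3.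
Proof.
move=> [e12 H12] [e23 H23]; split; first exact: leq_trans e23.
move=> e13; have e : epoch s1 = epoch s2 by lia.
have e' : epoch s2 = epoch s3 by lia.
have {H12} [D12 V12] := H12 e; have {H23} [D23 V23] := H23 e'; split.
  by case: D12 D23 => -> [] ->; auto.
move=> d1; have d2 : dissemination_timer s2 = None by case: D12 => ->.
case: (V12 d1) (V23 d2) => [[v12 n12]|[v12 t12]] [[v23 n23]|[v23 t23]].
- by left; split=> //; lia.
- by left; split=> //; lia.
- by left; split; [lia | case: t12 n23 => -> ].
by right; split; [lia | case: t12 t23 => -> [] ->; auto].
Qed.

Lemma core_le_refl c : core_le c c.
Proof. by split=> // _; split. Qed.

Lemma core_le_trans c1 c2 c3 : core_le c1 c2 -> core_le c2 c3 -> core_le c1 c3.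
Proof.
move=> [v12 F12 p12 l12 d12] [v23 F23 p23 l23 d23]; split; try lia.
  move=> v13; have [|A1 A2 A3 A4] := F12; first lia.
  have [|B1 B2 B3 B4] := F23; first lia.
  by split; [auto | auto | move=> x /A3/B3 | move=> x /A4/B4].
by move=> d1; have d2 := d12 d1; rewrite d23 // d2.
Qed.

Lemma wf_sync_cur s v : wf_sync s v -> (v <= gv (epoch s) f.+1)%N.
Proof.
case=> e0 v0 N S _; case: (dissemination_timer s) N S => [d|].
  by move=> _ [] // _; rewrite /global_view; lia.
by move=> -> // _; rewrite /global_view; lia.
Qed.

Lemma sync_stepP p clk (st : lstate) s c outs s' c' : wf_sync s (cur c) ->
  sync_step delta eps p clk st (s, c) outs (s', c') ->
  [/\ sync_le s s', wf_sync s' (cur c') &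
      c' = c \/ (cur c < cur c')%N /\ c' = advance (cur c') c].
Proof.
move=> wf; have vb := wf_sync_cur wf; case: wf => e0 v0 N S G H; inversion H; subst.
- have dN : dissemination_timer s = None.
    by case: (dissemination_timer s) S H4 => // d [] // ->.
  have E : expired (view_timer s) clk by [].
  have {}N := N dN; split=> /=.
  + split=> //= _; split=> [|_]; [by left | left; split=> // tN].
    by rewrite tN in E.
  + by split; rewrite ?dN //=; lia.
  + by right; rewrite /v N /global_view; split=> //; lia.
- have dN : dissemination_timer s = None.
    by case: (dissemination_timer s) S H4 => // d [] // ->.
  split=> /=; last by left.
  + by split=> //= _; split; auto.
  + by split=> //=; rewrite dN.
- split=> /=; last by left.
  + by split=> /=; lia.
  + split=> //= _; split=> //; last lia; apply: leq_ltn_trans vb _.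
    exact: ltn_global_view.
- split=> /=; last by left.
  + by split=> /=; lia.
  + split=> //= [|_]; first lia.
    split=> //; last lia; apply: leq_ltn_trans vb _.
    exact: ltn_global_view.
- have E : expired (dissemination_timer s) clk by [].
  have [dN|vN cv e1] := S; first by rewrite dN in E.
  split=> /=.
  + split=> //= _; split; first by right.
    by move=> dN; rewrite dN in E.
  + by split=> //=.
  + by right.
Qed.

Lemma core_stepP p (st : lstate) c outs c' : wf_core c ->
  core_step p st c outs c' -> [/\ core_le c c', wf_core c' & cur c' = cur c].
Proof.
move=> w H; case: H w => {c outs c'} /=.
- by move=> c Q qcs h _ _ _ _ _ _ [rp rl vp vl cp]; split=> //; split=> //= _; split.
- by move=> c x oq outs _ _ _ _ _ _ [rp rl vp vl cp]; split=> //; split=> //= _; split.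
- move=> c T x cert Q h _ _ _ _ _ [rp rl vp vl cp]; split=> //; split=> //= _.
  by split=> // T' T'v; rewrite inE T'v orbT.
- move=> c q _ _ vq qv [rp rl vp vl cp]; split=> //; split; rewrite //= ?qv //.
  by move=> _; split=> // T' T'v; rewrite inE T'v orbT.
- move=> c q _ _ vq qv [rp rl vp vl cp]; split=> //; split; rewrite //= ?qv //.
    by move=> _; split=> // T' T'v; rewrite inE T'v orbT.
  by move=> q' [<-].
- by move=> c q dN _ _ _ [rp rl vp vl cp]; split=> //; split=> //= _; split.
Qed.

Lemma advance_le v c : (cur c < v)%N -> core_le c (advance v c).
Proof. by move=> cv; split=> //=; lia. Qed.

Lemma advance_wf v c : wf_core c -> (cur c < v)%N -> wf_core (advance v c).
Proof. by case=> rp rl vp vl cp cv; split=> //=; lia. Qed.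

Definition wf (st : lstate) : Prop :=
  if quad st is Some (s, c) then
    [/\ started st, wf_sync s (cur c) & wf_core c]
  else True.

Definition state_le (st st' : lstate) : Prop :=
  [/\ started st -> started st',
      quad st' = None -> allow_any_sent st -> allow_any_sent st' &
      forall s c, quad st = Some (s, c) -> exists s' c',
        [/\ quad st' = Some (s', c'), sync_le s s' & core_le c c']].

Lemma state_le_refl st : state_le st st.
Proof.
by split=> // s c sc; exists s, c; split=> //; [exact: sync_le_refl | exact: core_le_refl].
Qed.

Lemma state_le_trans st1 st2 st3 :
  state_le st1 st2 -> state_le st2 st3 -> state_le st1 st3.
Proof.
move=> [s12 a12 q12] [s23 a23 q23]; split; first by auto.
  move=> q3 a1; apply: a23 => //; apply: a12 => //.
  case E: (quad st2) => [[s c]|] //.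
  by have [s' [c' []]] := q23 _ _ E; rewrite q3.
move=> s c /q12 [s' [c' [/q23 [s'' [c'' [q3 B1 B2]]] A1 A2]]].
by exists s'', c''; split=> //; [apply: sync_le_trans B1 | apply: core_le_trans B2].
Qed.

Lemma exit_value_certified ox c (y : V) : exit_value ox c y -> verify y c.
Proof. by case: ox => [z [? ->]|->] //; left. Qed.

Lemma pstep_le x p clk inc (st st' : lstate) outs : wf st ->
  pstep x p clk inc st outs st' -> wf st' /\ state_le st st'.
Proof.
rewrite /wf => w H; case: H w => {outs st'} /=.
- by move=> w; split=> //; apply: state_le_refl.
- move=> q m _ w; split=> //; split=> //= s c sc.
  by exists s, c; split=> //; [exact: sync_le_refl | exact: core_le_refl].
- move=> nst; case E: (quad st) => [[s c]|]; first by rewrite (negPf nst) => -[].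
  by split=> //; split=> //=; rewrite E.
- by move=> sst qN na _ _; rewrite qN; split=> //; split=> //=; rewrite qN.
- move=> ox c y sst qN _ /exit_value_certified ev _; split.
    by split=> //; rewrite /start_sync; split.
  by split=> //=; rewrite qN.
- move=> s c s' c' outs sst sc H; rewrite sc => -[_ ws wc].
  have [le ws' cc] := sync_stepP ws H.
  have {cc} [cle wc'] : core_le c c' /\ wf_core c'.
    case: cc => [->|[cv ->]]; first by split=> //; apply: core_le_refl.
    by split; [apply: advance_le | apply: advance_wf].
  by split=> //; split=> //= ? ?; rewrite sc => -[<- <-]; exists s', c'.
- move=> s c c' outs sst sc H; rewrite sc => -[_ ws wc].
  have [cle wc' ce] := core_stepP wc H.
  split; first by split=> //; rewrite ce.
  split=> //= ? ?; rewrite sc => -[<- <-]; exists s, c'; split=> //.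
  exact: sync_le_refl.
Qed.

Section Monotonicity.

Variable a : execution.

Lemma conf_wf i p : correct a p -> wf (conf a i p).
Proof.
move=> cp; elim: i => [|i IH]; first by rewrite conf0.
by have [] := pstep_le IH (executionP i cp).
Qed.

Lemma conf_le i j p : correct a p -> (i <= j)%N -> state_le (conf a i p) (conf a j p).
Proof.
move=> cp; elim: j => [|j IH]; first by rewrite leqn0 => /eqP ->; apply: state_le_refl.
rewrite leq_eqVlt => /predU1P[->|ij]; first exact: state_le_refl.
apply: state_le_trans (IH ij) _.
by have [] := pstep_le (conf_wf j cp) (executionP j cp).
Qed.

Lemma conf_wfP i p s c : correct a p -> quad (conf a i p) = Some (s, c) ->
  [/\ started (conf a i p), wf_sync s (cur c) & wf_core c].
Proof. by move=> cp q; move: (conf_wf i cp); rewrite /wf q. Qed.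

Lemma quad_le i j p s c s' c' : correct a p -> (i <= j)%N ->
  quad (conf a i p) = Some (s, c) -> quad (conf a j p) = Some (s', c') ->
  sync_le s s' /\ core_le c c'.
Proof.
move=> cp ij qi qj; have [_ _ H] := conf_le cp ij.
have [s2 [c2 []]] := H _ _ qi; rewrite qj => -[<- <-]; auto.
Qed.

Lemma quad_some i j p s c : correct a p -> (i <= j)%N ->
  quad (conf a i p) = Some (s, c) -> exists s' c',
  [/\ quad (conf a j p) = Some (s', c'), sync_le s s' & core_le c c'].
Proof. by move=> cp ij qi; have [_ _ H] := conf_le cp ij; apply: H. Qed.

End Monotonicity.

(** * Provenance of signatures *)

(** Views of one epoch are at most [f] apart, less than [nproc f], so their residues differ. *)
Lemma leader_inj e j k : (0 < e)%N -> (0 < j <= f.+1)%N -> (0 < k <= f.+1)%N ->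
  leader f (gv e j) = leader f (gv e k) -> j = k.
Proof.
move=> e0.
wlog jk : j k / (j <= k)%N.
  by move=> H hj hk E; case/orP: (leq_total j k) => ?; [|apply/esym]; apply: H.
move=> hj hk /(congr1 val); rewrite /= !inordK ?ltn_pmod // => /eqP.
rewrite eq_sym eqn_mod_dvd; last by rewrite /global_view leq_add2l.
rewrite /global_view subnDl => /dvdn_leq; rewrite /nproc.
by case: (ltnP 0 (k - j)%N) => [h /(_ isT)|]; lia.
Qed.

(** The places, apart from the inbox, where a process keeps threshold signatures that it may send
    later. *)
Definition has_tsig (st : lstate) (c : tsig) : Prop :=
  exists s k, quad st = Some (s, k) /\
    [\/ epoch_sig s = Some c, List.In c (qc_tsigs (prepareQC k)),
        List.In c (qc_tsigs (lockedQC k)) | c = cv_cert (proposal k)].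

Lemma learned_received (st : lstate) q m c : received st q m ->
  List.In c (msg_tsigs m) -> learned st c.
Proof. by move=> rm cm; right; exists q, m. Qed.

(** A correct process only stores, forwards or combines: no step brings up a threshold signature
    that was not at hand before it. *)
Lemma pstep_tsigs x p clk inc (st st' : lstate) outs c :
  pstep x p clk inc st outs st' ->
  has_tsig st' c \/ (exists o, List.In o outs /\ List.In c (msg_tsigs o.2)) ->
  has_tsig st c \/ learned st c.
Proof.
have bc q m (o : proc * msg) : List.In o (broadcast m ++ q) ->
    o.2 = m \/ List.In o q.
  by case: o => d m' /In_cat [/In_broadcast|]; auto.
have bc0 m (o : proc * msg) : List.In o (broadcast m) -> o.2 = m.
  by case: o => d m' /In_broadcast.
move=> H; case: H => {outs st'}.
- by case=> [|[o []]]; left.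
- by move=> q m _ [|[o []]]; left.
- by move=> _ [|[o [/bc0 ->]] //]; left.
- by move=> _ qN _ _ _ [[s [k []]] //|[o [/bc0 ->]] //].
- move=> ox d y _ qN ld ev core [[s [k [[<- <-] /=]]]|[o [/bc]]].
    by case=> // ->; right.
  by case=> [->|[<-|//]] //= [<-|//]; right.
- move=> s k s' k' outs _ sk H.
  have st_has d : epoch_sig s = Some d \/ List.In d (qc_tsigs (prepareQC k)) \/
      List.In d (qc_tsigs (lockedQC k)) \/ d = cv_cert (proposal k) ->
      has_tsig st d.
    move=> K; exists s, k; split=> //.
    by case: K => [|[|[]]]; [exact: Or41 | exact: Or42 | exact: Or43 | exact: Or44].
  inversion H; subst.
  + case=> [[? [? [[<- <-]]]] /=|[o [[<-|//] /=]]]; last by left; apply: st_has; tauto.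
    by case=> K; left; apply: st_has; tauto.
  + case=> [[? [? [[<- <-]]]] /=|[o [/bc0 -> //]]].
    by case=> K; left; apply: st_has; tauto.
  + case=> [[? [? [[<- <-]]]] /=|[o [] //]].
    case=> K; try by left; apply: st_has; tauto.
    right; left; case: K => <-.
    have [A [cA AP]] : at_least (2 * f).+1 (fun q => received st q
       (EpochCompleted e (PSig TwoFPlusOne q (CEpoch V e)))) by [].
    exists A; split=> // q /AP rq; exists (EpochCompleted e (PSig TwoFPlusOne q (CEpoch V e))).
    by split=> //; left.
  + case=> [[? [? [[<- <-]]]] /=|[o [] //]].
    case=> K; try by left; apply: st_has; tauto.
    right; case: K => <-.
    have rq : received st q (EnterEpoch f e (Some sg)) by [].
    by apply: learned_received rq _; left.
  + case=> [[? [? [[<- <-]]]] /=|[o [/bc]]].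
      by case=> K; left; apply: st_has; tauto.
    case=> [->|[<-|//]] /=; last by left; apply: st_has; tauto.
    case E: (epoch_sig s) => [sg|//] [<-|//]; left; apply: st_has; tauto.
- move=> s k k' outs _ sk H.
  have st_has d : epoch_sig s = Some d \/ List.In d (qc_tsigs (prepareQC k)) \/
      List.In d (qc_tsigs (lockedQC k)) \/ d = cv_cert (proposal k) ->
      has_tsig st d.
    move=> K; exists s, k; split=> //.
    by case: K => [|[|[]]]; [exact: Or41 | exact: Or42 | exact: Or43 | exact: Or44].
  case: H sk st_has => {k k' outs} /=.
  + move=> k Q qcs h _ _ _ rQ hQ _ sk st_has.
    have [rh _] := rQ _ hQ.
    case=> [[? [? [[<- <-]]]] /=|[o [/bc0 -> /=]]].
      by case=> K; left; apply: st_has; tauto.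
    case=> [<-|K]; last by right; apply: learned_received rh _.
    case: (qcs h) rh => [q|] rh; last by left; apply: st_has; tauto.
    by right; apply: learned_received rh _; left.
  + move=> k y oq outs _ rq _ _ safe_outs unsafe_outs sk st_has.
    case=> [[? [? [[<- <-]]]] /=|[o [oo]]].
      by case=> K; left; apply: st_has; tauto.
    case: (EM (safe (cv_val y) oq (lockedQC k))) => sf.
      move: oo; rewrite safe_outs // => -[<-|//] /= [<-|//].
      by right; apply: learned_received rq _; left.
    by rewrite unsafe_outs in oo.
  + move=> k T y cert Q h _ _ cQ rQ hQ sk st_has.
    case=> [[? [? [[<- <-]]]] /=|[o [/bc0 ->]]].
      by case=> K; left; apply: st_has; tauto.
    have [_ rh] := rQ _ hQ => K.
    have {K} [<-|[<-|//]] : List.In c (qc_tsigs (Some (QC T (cur k) (CVal y (cert h))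
        (TSig TwoFPlusOne (CVote T y (cur k)))))) by case: T {rQ rh} K.
      by right; apply: learned_received rh _; left.
    right; left; exists Q; split=> // q /rQ [_ rq].
    exists (Vote T (cur k) (CVal y (cert q)) (vote_sig q T y (cur k))).
    by split=> //; left.
  + move=> k q _ rq vq qv sk st_has.
    case=> [[? [? [[<- <-]]]] /=|[o [[<-|//] /= [<-|//]]]]; last first.
      by right; apply: learned_received rq _; left.
    case=> K; try by left; apply: st_has; tauto.
    by right; apply: learned_received rq _.
  + move=> k q _ rq vq qv sk st_has.
    case=> [[? [? [[<- <-]]]] /=|[o [[<-|//] /= [<-|//]]]]; last first.
      by right; apply: learned_received rq _; left.
    case=> K; try by left; apply: st_has; tauto.
    by right; apply: learned_received rq _.
  + move=> k q _ rq vq qv sk st_has.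
    case=> [[? [? [[<- <-]]]] /=|[o [] //]].
    by case=> K; left; apply: st_has; tauto.
Qed.

(* [prepare_seen] also holds when the vote was withheld: this means that no vote
   of type [T] will be sent in the current view any more. *)
Definition vote_done (T : vtype) (c : core_state) : bool :=
  if T is VPrepare then prepare_seen c else T \in voted c.

Definition vote_reason (T : vtype) (st : lstate) (c c' : core_state)
    (y : cval V) : Prop :=
  match T with
  | VPrepare => exists oq,
      [/\ received st (leader f (cur c)) (Prepare f (cur c) y oq),
          certified y, valid_prepareQC oq & safe (cv_val y) oq (lockedQC c)]
  | VPrecommit => exists q,
      [/\ received st (leader f (cur c)) (Precommit f q), valid_qc VPrepare q,
          qc_view q = cur c, qc_value q = y & prepareQC c' = Some q]
  | VCommit => exists q,
      [/\ received st (leader f (cur c)) (Commit f q), valid_qc VPrecommit q,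
          qc_view q = cur c, qc_value q = y & lockedQC c' = Some q]
  end.

(** Each constructor keeps the guard of the rule that produced the partial signature; this is what a
    correct member of a quorum testifies to. *)
Variant signs (x : V) (p : proc) (clk : R) (st : lstate) (outs : outputs)
    (st' : lstate) : scheme -> content -> Prop :=
| SignsValue : signs x p clk st outs st' FPlusOne (CValue x)
| SignsAny :
    at_least (2 * f).+1%N (fun q => exists y, disclosed st y q) ->
    (forall y, ~ at_least f.+1 (disclosed st y)) ->
    signs x p clk st outs st' FPlusOne (CAny V)
| SignsEpoch s c : quad st = Some (s, c) -> expired (view_timer s) clk ->
    (f.+1 <= view s)%N ->
    signs x p clk st outs st' TwoFPlusOne (CEpoch V (epoch s))
| SignsVote T s c c' y : quad st = Some (s, c) -> quad st' = Some (s, c') ->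
    cur c' = cur c -> ~~ vote_done T c -> vote_done T c' ->
    outs = vote_out p T (cur c) y -> vote_reason T st c c' y ->
    signs x p clk st outs st' TwoFPlusOne (CVote T (cv_val y) (cur c)).

Lemma pstep_signs x p clk inc (st st' : lstate) outs o s :
  pstep x p clk inc st outs st' -> List.In o outs ->
  List.In s (msg_psigs o.2) ->
  ps_signer s = p /\ signs x p clk st outs st' (ps_scheme s) (ps_content s).
Proof.
have bc q m (o' : proc * msg) : List.In o' (broadcast m ++ q) ->
    o'.2 = m \/ List.In o' q.
  by case: o' => d m' /In_cat [/In_broadcast|]; auto.
have bc0 m (o' : proc * msg) : List.In o' (broadcast m) -> o'.2 = m.
  by case: o' => d m' /In_broadcast.
move=> H; case: H => {outs st'} //.
- by move=> _ /bc0 -> [<-|//]; split=> //; apply: SignsValue.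
- by move=> _ _ _ A B /bc0 -> [<-|//]; split=> //; apply: SignsAny.
- by move=> ox d y _ _ _ _ core /bc [->|[<-|//]].
- move=> u k u' k' outs _ sk H; inversion H; subst => //.
  + by case=> // <-.
  + by move=> /bc0 -> [<-|//]; split=> //; apply: SignsEpoch sk _ _.
  + by move=> /bc [->|[<-|//]].
- move=> u k k' outs _ sk H; case: H sk => {k k' outs} /=.
  + by move=> k Q qcs h _ _ _ _ _ _ sk /bc0 ->.
  + move=> k y oq outs nps rq cy vq safe_outs unsafe_outs sk oo.
    case: (EM (safe (cv_val y) oq (lockedQC k))) => sf; last by rewrite unsafe_outs in oo.
    move: oo; rewrite (safe_outs sf) => -[<- /= [<-|//]|//] /=; split=> //.
    by apply: SignsVote sk _ _ _ _ _ _ => //=; exists oq.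
  + by move=> k T y cert Q h _ _ _ _ _ sk /bc0 ->; case: T.
  + move=> k q nv rq vq qv sk [<-|//] [<-|//]; split=> //.
    by apply: SignsVote sk _ _ _ _ _ _ => //=; exists q.
  + move=> k q nv rq vq qv sk [<-|//] [<-|//]; split=> //.
    by apply: SignsVote sk _ _ _ _ _ _ => //=; exists q.
  + by move=> k q _ _ _ _ _ [].
Qed.

Section Signatures.

Variable a : execution.

Definition supported (i : nat) (c : tsig) : Prop :=
  at_least (threshold f (ts_scheme c)) (fun q => correct a q ->
    produced_before a i (PSig (ts_scheme c) q (ts_content c))).

Lemma produced_mono i j s : (i <= j)%N -> produced_before a i s ->
  produced_before a j s.
Proof.
move=> ij [k [d [m [ki H1 H2]]]]; exists k, d, m; split=> //.
exact: leq_trans ij.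
Qed.

Lemma supported_mono i j c : (i <= j)%N -> supported i c -> supported j c.
Proof.
move=> ij; apply: at_least_sub => q H cq; exact: produced_mono ij (H cq).
Qed.

Lemma byz_sends i p d m : ~~ correct a p -> List.In (p, d, m) (sends a i) ->
  unforgeable a i m.
Proof.
move=> cp; move: (steps_valid a i); rewrite /valid_step /sends.
case: (ev a i) => [|q outs|b outs|j k] //.
- by case=> cq _ _ /In_map [o [_ [qp _ _]]]; rewrite -qp cq in cp.
- by case=> _ un _ /In_map [o [/un H [_ _ <-]]].
Qed.

(** Messages and states need a joint induction: what a correct process sends comes from its state
    and inbox, what it stores comes from earlier messages, and Byzantine messages are covered by
    [unforgeable]. *)
Lemma supported_tsigs i :
  (forall j p d m c, (j < i)%N -> List.In (p, d, m) (sends a j) ->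
     List.In c (msg_tsigs m) -> supported j c) /\
  (forall p c, correct a p -> has_tsig (conf a i p) c \/ learned (conf a i p) c ->
     supported i c).
Proof.
have L j p c : (forall k q d m c, (k < j)%N -> List.In (q, d, m) (sends a k) ->
     List.In c (msg_tsigs m) -> supported k c) -> correct a p ->
     learned (conf a j p) c -> supported j c.
  move=> IH cp [[A [cA AP]]|[q [m [rm cm]]]].
    exists A; split=> // q /AP [m [rm sm]] cq.
    have [k [kj km]] := received_sent cp rm.
    by exists k, p, m; split.
  have [k [kj km]] := received_sent cp rm.
  by apply: supported_mono (IH _ _ _ _ _ kj km cm); apply: ltnW.
elim: i => [|i [IHm IHs]].
  split=> // p c cp [[s [k []]]|]; first by rewrite conf0.
  exact: L.
have M j p d m c : (j < i.+1)%N -> List.In (p, d, m) (sends a j) ->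
     List.In c (msg_tsigs m) -> supported j c.
  rewrite ltnS leq_eqVlt => /predU1P[->|]; last exact: IHm.
  move=> pm cm; case: (boolP (correct a p)) => cp; last first.
    by have [_ H] := byz_sends cp pm; apply: H.
  apply: (IHs p) => //.
  apply: (pstep_tsigs (executionP i cp)); right.
  by move/In_sends: pm => pm; exists (d, m).
split=> // p c cp [H|]; last exact: L.
apply: (supported_mono (leqnSn i)); apply: (IHs p) => //.
by apply: (pstep_tsigs (executionP i cp)); left.
Qed.

Lemma has_tsig_supported i p c : correct a p -> has_tsig (conf a i p) c ->
  supported i c.
Proof. by move=> cp H; apply: (supported_tsigs i).2 cp _; left. Qed.

Lemma learned_supported i p c : correct a p -> learned (conf a i p) c ->
  supported i c.
Proof. by move=> cp H; apply: (supported_tsigs i).2 cp _; right. Qed.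

Lemma received_supported i p q m c : correct a p -> received (conf a i p) q m ->
  List.In c (msg_tsigs m) -> supported i c.
Proof. by move=> cp rm cm; apply: (learned_supported cp); right; exists q, m. Qed.

Lemma produced_signs i p sch ct : correct a p ->
  produced_before a i (PSig sch p ct) -> exists j, (j < i)%N /\
  signs (input a p) p (clock a p (time a j)) (conf a j p) (outs_of a j p)
    (conf a j.+1 p) sch ct.
Proof.
move=> cp [j [d [m [ji /In_sends pm sm]]]]; exists j; split=> //.
by have [] := pstep_signs (executionP j cp) pm sm.
Qed.

Lemma vote_inv i p T x v : correct a p ->
  produced_before a i (PSig TwoFPlusOne p (CVote T x v)) ->
  exists j s c c' y, [/\ (j < i)%N, quad (conf a j p) = Some (s, c),
    quad (conf a j.+1 p) = Some (s, c'), (cur c = v /\ cur c' = v) &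
    [/\ cv_val y = x, ~~ vote_done T c, vote_done T c',
      outs_of a j p = vote_out p T v y & vote_reason T (conf a j p) c c' y]].
Proof.
move=> cp /(produced_signs cp) [j [ji H]]; exists j.
inversion H as [| | |T' s c c' y q q' cc d d' oo r]; subst.
by exists s, c, c', y; split.
Qed.

Lemma vote_done_le T c c' : core_le c c' -> cur c = cur c' ->
  vote_done T c -> vote_done T c'.
Proof. by case=> _ H _ _ _ /H [H1 _ H2 _]; case: T => //=; auto. Qed.

(** After the first of two votes its flag stays set as long as the view is the same, so the second
    cannot come at a later step; at the same step the output is a single vote. *)
Lemma vote_unique i j p T x y v : correct a p ->
  produced_before a i (PSig TwoFPlusOne p (CVote T x v)) ->
  produced_before a j (PSig TwoFPlusOne p (CVote T y v)) -> x = y.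
Proof.
move=> cp /(vote_inv cp) [k [s [c [c' [z [_ q1 q1' [cv cv'] [zx d1 d1' o1 _]]]]]]].
move=> /(vote_inv cp) [l [u [e [e' [z' [_ q2 q2' [ev ev'] [zy d2 d2' o2 _]]]]]]].
case: (ltngtP k l) => [kl|lk|kl].
- have [_ le] := quad_le cp kl q1' q2.
  by rewrite (vote_done_le le _ d1') // cv' ev in d2.
- have [_ le] := quad_le cp lk q2' q1.
  by rewrite (vote_done_le le _ d2') // cv ev' in d1.
- by subst l; move: o2; rewrite o1 => -[zz _]; rewrite -zx -zy zz.
Qed.

Lemma correct_mem (A : {set proc}) : (f < #|A|)%N ->
  exists q, q \in A /\ correct a q.
Proof.
move=> fA; have : ~~ (A \subset byz a).
  by apply/negP => /subset_leq_card; have := byz_bound a; lia.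
by case/subsetPn => q qA qb; exists q.
Qed.

Lemma exists_correct : exists p, correct a p.
Proof.
have [|p [_ cp]] := @correct_mem setT; last by exists p.
by rewrite cardsT card_ord /nproc; lia.
Qed.

Lemma exists_correct_leader e : (0 < e)%N ->
  exists k, (0 < k <= f.+1)%N /\ correct a (leader f (gv e k)).
Proof.
move=> e0; pose g (k : 'I_f.+1) := leader f (gv e k.+1).
have g_inj : injective g.
  move=> j k jk; apply/val_inj/eq_add_S.
  by apply: (leader_inj e0 _ _ jk); exact: ltn_ord.
have [|p [/imsetP [k _ ->] cp]] := @correct_mem (g @: setT).
  by rewrite card_imset // cardsT card_ord.
by exists k.+1; rewrite /= ltn_ord.
Qed.

Lemma at_least_correct (P : proc -> Prop) : at_least f.+1 P ->
  exists q, correct a q /\ P q.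
Proof.
by case=> A [cA AP]; have [q [/AP Pq cq]] := correct_mem cA; exists q.
Qed.

Lemma at_least_cap (P Q : proc -> Prop) : at_least (2 * f).+1 P ->
  at_least (2 * f).+1 Q -> at_least f.+1 (fun q => P q /\ Q q).
Proof.
move=> [A [cA AP]] [B [cB BQ]]; exists (A :&: B); split.
  have : (#|A :|: B| <= (3 * f).+1)%N.
    by apply: leq_trans (max_card _) _; rewrite card_ord.
  by have := cardsUI A B; lia.
by move=> q /setIP [/AP Pq /BQ Qq].
Qed.

Lemma quorum_cap (P Q : proc -> Prop) : at_least (2 * f).+1 P ->
  at_least (2 * f).+1 Q -> exists q, [/\ correct a q, P q & Q q].
Proof.
by move=> HP HQ; have [q [cq [Pq Qq]]] := at_least_correct (at_least_cap HP HQ); exists q.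
Qed.

Lemma quorum_correct (P : proc -> Prop) : at_least (2 * f).+1 P ->
  exists q, correct a q /\ P q.
Proof. by move=> HP; have [q [cq Pq _]] := quorum_cap HP HP; exists q. Qed.

Lemma at_least_all_correct (P : proc -> Prop) :
  (forall q, correct a q -> P q) -> at_least (2 * f).+1 P.
Proof.
move=> H; exists (~: byz a); split; last by move=> q; rewrite inE; apply: H.
by have := cardsC (byz a); have := byz_bound a; rewrite card_ord /nproc; lia.
Qed.

Lemma quorum_unique i j T x y v :
  supported i (TSig TwoFPlusOne (CVote T x v)) ->
  supported j (TSig TwoFPlusOne (CVote T y v)) -> x = y.
Proof.
move=> sx sy; have [q [cq Px Py]] := quorum_cap sx sy.
exact: vote_unique cq (Px cq) (Py cq).
Qed.

End Signatures.

(** * Agreement and validity *)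

Section Safety.

Variable a : execution.

Lemma in_qc_sig (q : qc V) : List.In (qc_sig q) (qc_tsigs (Some q)).
Proof. by right; left. Qed.

(** One correct vote of the quorum is enough, since it answers a QC of the preceding type that
    existed before the vote. *)
Lemma commit_supported i x v :
  supported a i (TSig TwoFPlusOne (CVote VCommit x v)) ->
  exists j, (j < i)%N /\ supported a j (TSig TwoFPlusOne (CVote VPrecommit x v)).
Proof.
move=> /(quorum_correct a) [p [cp /(_ cp)]].
move=> /(vote_inv cp) [j [s [c [c' [y [ji _ _ [cv _] [<- _ _ _]]]]]]].
move=> [q [rq [_ _ sq] qv qy _]]; exists j; split=> //.
rewrite -qy -cv -qv -sq; apply: received_supported cp rq (in_qc_sig q).
Qed.

Lemma precommit_supported i x v :
  supported a i (TSig TwoFPlusOne (CVote VPrecommit x v)) ->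
  exists j, (j < i)%N /\ supported a j (TSig TwoFPlusOne (CVote VPrepare x v)).
Proof.
move=> /(quorum_correct a) [p [cp /(_ cp)]].
move=> /(vote_inv cp) [j [s [c [c' [y [ji _ _ [cv _] [<- _ _ _]]]]]]].
move=> [q [rq [_ _ sq] qv qy _]]; exists j; split=> //.
rewrite -qy -cv -qv -sq; apply: received_supported cp rq (in_qc_sig q).
Qed.

Lemma locked_supported i p s c q : correct a p ->
  quad (conf a i p) = Some (s, c) -> lockedQC c = Some q ->
  supported a i (TSig TwoFPlusOne (CVote VPrecommit (cv_val (qc_value q)) (qc_view q))).
Proof.
move=> cp sc lq; have [_ _ [_ _ _ H _]] := conf_wfP cp sc.
have [_ _ <-] := H _ lq; apply: has_tsig_supported cp _.
by exists s, c; split=> //; apply: Or43; rewrite lq; apply: in_qc_sig.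
Qed.

(* A process that votes COMMIT for [x] in [v] is locked on [x]; it can vote for
   another value only on a QC of a view above the lock, and that QC, which was
   formed earlier, is for [x] by induction on time. Views do not suffice for the
   induction, as Byzantine leaders may show QCs of views above the current one. *)
Lemma lock_safe k x v : supported a k (TSig TwoFPlusOne (CVote VCommit x v)) ->
  forall i y w, (v <= w)%N ->
  supported a i (TSig TwoFPlusOne (CVote VPrepare y w)) -> y = x.
Proof.
move=> sx; elim/ltn_ind => i IH y w; rewrite leq_eqVlt => /predU1P[<-|vw] sy.
  have [k' [_ sx']] := commit_supported sx.
  have [k'' [_ sx'']] := precommit_supported sx'.
  exact: quorum_unique sy sx''.
have [p [cp /(_ cp) Px /(_ cp) Py]] := quorum_cap a sx sy.
have [j1 [s1 [c1 [c1' [z1 [_ q1 q1' [cv cv'] [_ _ _ _ r1]]]]]]] := vote_inv cp Px.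
have [j2 [s2 [c2 [c2' [z2 [j2i q2 _ [cw _] [zy _ _ _ r2]]]]]]] := vote_inv cp Py.
have j12 : (j1 < j2)%N.
  rewrite ltnNge; apply/negP => j21.
  by have [_ [le _ _ _ _]] := quad_le cp j21 q2 q1; lia.
have [_ [_ _ _ le _]] := quad_le cp j12 q1' q2.
case: r1 => l1 [_ _ l1v _ l1E]; move: le; rewrite l1E /=.
case l2E: (lockedQC c2) => [l2|//] /= le.
have {}le : (v <= qc_view l2)%N by lia.
have [j3 [j32 sl]] := precommit_supported (locked_supported cp q2 l2E).
have l2x : cv_val (qc_value l2) = x by apply: IH le sl; lia.
case: r2 => oq [ro _ vo [oy lk]]; rewrite zy l2E in oy lk.
case: lk => [//|<- //|].
case: oq ro vo oy => [o|//] ro [_ _ vo] [//|<-] /= lo.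
apply: (IH j2 _ _ (qc_view o)) => //; first lia.
rewrite -vo; apply: received_supported cp ro _.
by right; apply: in_qc_sig.
Qed.

Lemma decided_inv i p x : correct a p -> decided (conf a i p) = Some x ->
  exists q, [/\ received (conf a i p) (leader f (qc_view q)) (Decide f q),
    valid_qc VCommit q & cv_val (qc_value q) = x].
Proof.
move=> cp; elim: i => [|i IH]; first by rewrite conf0.
move=> dx; have st := executionP i cp.
suff H : decided (conf a i p) = Some x \/ exists q,
    [/\ received (conf a i p) (leader f (qc_view q)) (Decide f q),
    valid_qc VCommit q & cv_val (qc_value q) = x].
  have [q [r v e]] : exists q,
    [/\ received (conf a i p) (leader f (qc_view q)) (Decide f q),
      valid_qc VCommit q & cv_val (qc_value q) = x] by case: H => [/IH|].
  by exists q; split=> //; apply: pstep_received st r.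
have wf := conf_wfP (i := i) cp.
move: dx wf; rewrite /decided; case: st => /=; try by left.
- move=> s c s' c' outs _ sc H; rewrite sc => dc /(_ _ _ erefl) [_ ws _]; left.
  have [_ _ [<- //|[_ cc]]] := sync_stepP ws H.
  by move: dc; rewrite cc.
- move=> s c c' outs _ sc H; rewrite sc => dc _.
  case: H dc => /=; try by left.
  by move=> {c sc c' outs} c q dN rq vq qv [dx]; right; exists q; rewrite qv.
Qed.

Lemma decided_supported i p x : correct a p -> decided (conf a i p) = Some x ->
  exists v, supported a i (TSig TwoFPlusOne (CVote VCommit x v)).
Proof.
move=> cp /(decided_inv cp) [q [rq [_ _ sq] <-]]; exists (qc_view q).
by rewrite -sq; apply: received_supported cp rq (in_qc_sig q).
Qed.

Lemma execution_agreement : agreement a.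
Proof.
suff H i j v w x y : (v <= w)%N ->
    supported a i (TSig TwoFPlusOne (CVote VCommit x v)) ->
    supported a j (TSig TwoFPlusOne (CVote VCommit y w)) -> y = x.
  move=> p q x y cp cq [i /(decided_supported cp) [v sx]].
  move=> [j /(decided_supported cq) [w sy]].
  by case/orP: (leq_total v w) => vw; [apply/esym|]; apply: H vw _ _; eauto.
move=> vw sx /commit_supported [j' [_ /precommit_supported [j'' [_ sy]]]].
exact: lock_safe sx _ _ _ vw sy.
Qed.

Lemma disclosed_input i p q x : correct a p -> correct a q ->
  disclosed (conf a i p) x q -> x = input a q.
Proof.
move=> cp cq /(received_sent cp) [j [_ /In_sends H]].
have [|_ K] := pstep_signs (s := PSig FPlusOne q (CValue x)) (executionP j cq) H.
  by left.
by inversion K.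
Qed.

(** The certificate of the decided value needs the share of a correct process. A share for a value
    is for that process's own input. A share for [CAny] was given after [2f+1] disclosures without
    [f+1] equal ones; but [f+1] of them come from correct processes, which all disclose [x]. *)
Lemma execution_validity : validity a.
Proof.
move=> x allx p y cp [i /(decided_inv cp) [q [rq [_ vq _] <-]]].
have sc : supported a i (cv_cert (qc_value q)).
  by apply: received_supported cp rq _; left.
case: vq => E; move: sc; rewrite E => sc;
  have [r [cr /(_ cr) /(produced_signs cr) [j [ji K]]]] := at_least_correct a sc.
  inversion K as [|D nD| |]; subst.
  have all_correct : at_least (2 * f).+1 (fun q => correct a q).
    exact: (at_least_all_correct (a := a)).
  case: (nD x); have [A [cA AP]] := at_least_cap D all_correct.
  exists A; split=> // u /AP [[z uz] cu].
  by rewrite -(allx u cu) -(disclosed_input cr cu uz).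
by inversion K; rewrite allx.
Qed.

End Safety.

(** * Messages behind the flags of a state *)

(** Here and below, [M d m] stands for [m] having been sent to [d]. A flag stops a process from
    acting again, so progress arguments need to know that the action behind the flag has produced
    its messages. *)
Definition core_history (p : proc) (c : core_state) (M : proc -> msg -> Prop) :=
  [/\ exists oq, valid_prepareQC oq /\
        M (leader f (cur c)) (ViewChange f (cur c) oq),
      proposed c -> exists x oq, [/\ certified x, valid_prepareQC oq &
        forall d, M d (Prepare f (cur c) x oq)],
      forall T, T \in announced c -> exists q,
        [/\ valid_qc T q, qc_view q = cur c & forall d, M d (announce f T q)] &
      forall T, T \in voted c -> exists y, certified y /\
        M (leader f (cur c)) (Vote T (cur c) y (vote_sig p T (cv_val y) (cur c)))].

Definition sync_history (p : proc) (s : sync_state) (M : proc -> msg -> Prop) :=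
  ((1 < epoch s)%N -> dissemination_timer s = None -> forall d,
     M d (EnterEpoch f (epoch s) (Some (TSig TwoFPlusOne (CEpoch V (epoch s).-1))))) /\
  (dissemination_timer s = None -> view_timer s = None -> forall d,
     M d (EpochCompleted (epoch s) (PSig TwoFPlusOne p (CEpoch V (epoch s))))).

Definition history (x : V) (p : proc) (st : lstate) (M : proc -> msg -> Prop) :=
  [/\ started st -> forall d, M d (Disclose x (PSig FPlusOne p (CValue x))),
      allow_any_sent st -> forall d, M d (AllowAny (PSig FPlusOne p (CAny V))),
      forall s c, quad st = Some (s, c) -> sync_history p s M /\ core_history p c M &
      quad st <> None -> exists ox c y,
        exit_value ox c y /\ forall d, M d (Certificate f ox c)].

Lemma core_history_sub p c (M M' : proc -> msg -> Prop) :
  (forall d m, M d m -> M' d m) -> core_history p c M -> core_history p c M'.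
Proof.
move=> MM [[oq [vo Mo]] P A V']; split.
- by exists oq; auto.
- by move=> /P [x [o [cx co H]]]; exists x, o; split; auto.
- by move=> T /A [q [cq vq H]]; exists q; split; auto.
- by move=> T /V' [y [cy H]]; exists y; auto.
Qed.

Lemma history_sub x p st (M M' : proc -> msg -> Prop) :
  (forall d m, M d m -> M' d m) -> history x p st M -> history x p st M'.
Proof.
move=> MM [S A Q E]; split; try by auto.
  move=> s c /Q [[H1 H2] /(core_history_sub MM) H3]; split=> //.
  by split; auto.
by move=> /E [ox [c [y [ev H]]]]; exists ox, c, y; auto.
Qed.

Lemma advance_history p v c (M : proc -> msg -> Prop) oq :
  valid_prepareQC oq -> M (leader f v) (ViewChange f v oq) ->
  core_history p (advance v c) M.
Proof. by move=> vo Mo; split=> //=; exists oq. Qed.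

Lemma pstep_history x p clk inc (st st' : lstate) outs M : wf st ->
  pstep x p clk inc st outs st' -> history x p st M ->
  history x p st' (fun d m => M d m \/ List.In (d, m) outs).
Proof.
move=> w H; pose M' d m := M d m \/ List.In (d, m) outs.
move=> /(history_sub (M' := M') (fun d m => @or_introl _ _)).
rewrite -[fun d m => _]/M'.
have bc m : (forall d, List.In (d, m) outs) -> forall d, M' d m by right.
have one d m : List.In (d, m) outs -> M' d m by right.
have inb (d : proc) (m : msg) q : List.In (d, m) (broadcast m ++ q).
  by apply/In_cat; left; apply/In_broadcast.
have inb0 (d : proc) (m : msg) : List.In (d, m) (broadcast m) by apply/In_broadcast.
move: M' bc one => M' bc one; case: H w bc one => {outs st'} /=.
- by [].
- by move=> q m _ _ _ _ [S A Q E]; split.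
- by move=> _ _ bc one [S A Q E]; split=> //= _; apply: bc.
- move=> sst qN _ _ _ _ bc one [S A Q E]; split=> //= _; first exact: S.
  exact: bc.
- move=> ox c y sst qN lc ev _ bc one [S A Q E]; split=> //=; last first.
    by move=> _; exists ox, c, y; split=> // d; apply: bc.
  move=> _ _ [<- <-]; split; first by split.
  apply: (@advance_history _ _ _ _ None) => //.
  apply: one; apply/In_cat; right; left.
  done.
- move=> s c s' c' outs sst sc H w bc one; move: w (w); rewrite {1}/wf sc.
  case=> _ ws [_ _ vp _ _] w [S A Q E]; have [[En Co] Ch] := Q _ _ sc.
  split=> //=; last by move=> _; apply: E; rewrite sc.
  move=> _ _ [<- <-]; inversion H; subst.
  + split; last by apply: (@advance_history _ _ _ _ (prepareQC c)) => //; apply: one; left.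
    by split.
  + by split=> //; split=> // _ _ d; apply: bc.
  + by split=> //; split.
  + by split=> //; split.
  + split; last first.
      apply: (@advance_history _ _ _ _ (prepareQC c)) => //; apply: one.
      by apply/In_cat; right; left.
    split=> //= e1 _ d; apply: bc => d'; case: ws => _ _ _ _ /(_ e1) <-.
    exact: inb.
- move=> s c c' outs sst sc H w bc one; case=> S A Q E.
  have [Sh Ch] := Q _ _ sc; split=> //=; last by move=> _; apply: E; rewrite sc.
  move=> _ _ [<- <-]; split=> //; case: H w sc bc one Ch => {c c' outs} /=.
  + move=> c B qcs h _ _ _ rB hB _ w sc bc one [V0 P N O]; split=> //= _.
    exists (if qcs h is Some q then qc_value q else proposal c), (qcs h).
    have [_ vh] := rB _ hB; split=> //; last by move=> d; apply: bc.
    case: (qcs h) vh => [q [] //|_].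
    by move: w; rewrite /wf sc => -[_ _ []].
  + by move=> c y oq outs _ _ _ _ _ _ w sc bc one [V0 P N O]; split.
  + move=> c T y cert B h _ _ _ rB hB w sc bc one [V0 P N O]; split=> //= T'.
    rewrite inE => /predU1P[->|/N //].
    exists (QC T (cur c) (CVal y (cert h)) (TSig TwoFPlusOne (CVote T y (cur c)))).
    have [vy _] := rB _ hB; split=> //.
    by move=> d; apply: bc.
  + move=> c q _ rq vq qv w sc bc one [V0 P N O]; split=> //= T.
    rewrite inE => /predU1P[->|/O //]; exists (qc_value q); split; first by case: vq.
    by apply: one; left.
  + move=> c q _ rq vq qv w sc bc one [V0 P N O]; split=> //= T.
    rewrite inE => /predU1P[->|/O //]; exists (qc_value q); split; first by case: vq.
    by apply: one; left.
  + by move=> c q _ _ _ _ w sc bc one [V0 P N O]; split.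
Qed.

Section History.

Variable a : execution.

Lemma conf_history i p : correct a p ->
  history (input a p) p (conf a i p) (fun d m => sent a i p d m).
Proof.
move=> cp; elim: i => [|i IH]; first by rewrite conf0.
apply: history_sub (pstep_history (conf_wf i cp) (executionP i cp) IH).
by move=> d m H; apply/sentS.
Qed.

(** The flag [prepare_seen] does not tell whether a vote was sent: this depended on the lock when
    PREPARE was handled. The state of that moment is therefore kept, and [leader_safe] is applied to
    it later. *)
Definition prepare_handled (p : proc) (st : lstate) (v : nat)
    (M : proc -> msg -> Prop) :=
  exists s c y oq, [/\ quad st = Some (s, c), cur c = v,
    received st (leader f v) (Prepare f v y oq), certified y &
    valid_prepareQC oq /\ (safe (cv_val y) oq (lockedQC c) ->
      M (leader f v) (Vote VPrepare v y (vote_sig p VPrepare (cv_val y) v)))].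

Lemma pstep_prepare x p clk inc (st st' : lstate) outs s c : wf st ->
  pstep x p clk inc st outs st' ->
  quad st' = Some (s, c) -> prepare_seen c ->
  (exists s0 c0, [/\ quad st = Some (s0, c0), prepare_seen c0 & cur c0 = cur c]) \/
  prepare_handled p st (cur c) (fun d m => List.In (d, m) outs).
Proof.
move=> w H; case: H w => {outs st'} /=; try by intros; left; exists s, c.
- by move=> ox d y _ _ _ _ _ [_ <-].
- move=> s0 c0 s' c' outs _ sc0 H; rewrite /wf sc0 => -[_ ws _] [_ <-].
  have [_ _ [->|[_ ->//]]] := sync_stepP ws H.
  by left; exists s0, c0.
- move=> s0 c0 c' outs _ sc0 H _ [_ <-]; case: H sc0 => {c0 c' outs} /=;
    try by intros; left; do 2 eexists; split; eauto.
  move=> c0 y oq outs _ rq cy vo sf usf sc0 _; right.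
  exists s0, c0, y, oq; split=> //; split=> // /sf ->.
  by left.
Qed.

Lemma prepare_history i p s c : correct a p ->
  quad (conf a i p) = Some (s, c) -> prepare_seen c ->
  exists j, (j < i)%N /\
    prepare_handled p (conf a j p) (cur c) (fun d m => sent a i p d m).
Proof.
move=> cp; elim: i s c => [|i IH] s c; first by rewrite conf0.
move=> sc ps; have := pstep_prepare (conf_wf i cp) (executionP i cp) sc ps.
case=> [[s0 [c0 [q0 ps0 <-]]]|[s0 [c0 [y [oq [q0 cc rq cy [vo sf]]]]]]].
  have [j [ji [s1 [c1 [y [oq [q1 cc rq cy [vo sf]]]]]]]] := IH _ _ q0 ps0.
  exists j; split; first exact: ltnW.
  exists s1, c1, y, oq; split=> //; split=> // /sf.
  exact: sent_mono.
exists i; split=> //; exists s0, c0, y, oq; split=> //; split=> // /sf H.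
by apply/sentS; right.
Qed.

End History.

(** * Delays after GST *)

Hypotheses (delta_gt0 : 0 < delta) (eps_gt0 : 0 < eps).

Ltac lra_delays := move: delta_gt0 eps_gt0 => ? ?; lra.

Ltac lia_nat := repeat match goal with
  | H : is_true (@Order.le ring_display _ _ _) |- _ => clear H
  | H : is_true (@Order.lt ring_display _ _ _) |- _ => clear H end; lia.

Section Timing.

Variable a : execution.

Definition at_time (t : R) (p : proc) : lstate := conf a (steps_until a t) p.

Lemma steps_until_gt t : t < time a (steps_until a t).
Proof. by rewrite ltNge -ltn_steps_until ltnn. Qed.

Lemma steps_until_gt0 t p : correct a p -> gst a <= t -> (0 < steps_until a t)%N.
Proof.
move=> cp gt; rewrite lt0n; apply/negP => /eqP N0.
have := start_by_gst cp (le_lt_trans gt (steps_until_gt t)).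
by rewrite N0 conf0.
Qed.

Lemma time_last_step t p : correct a p -> gst a <= t ->
  time a (steps_until a t).-1 <= t.
Proof. by move=> cp gt; rewrite -ltn_steps_until prednK ?(steps_until_gt0 cp gt). Qed.

Lemma started_at t p : correct a p -> gst a <= t -> started (at_time t p).
Proof.
by move=> cp gt; apply: start_by_gst cp (le_lt_trans gt (steps_until_gt t)).
Qed.

(** This is [zero_time_steps] at the last step up to [t], since the step after it is strictly later
    than [t]. *)
Lemma quiescent t p outs st' : correct a p -> gst a <= t ->
  ~ local_step delta eps p (clock a p t) (at_time t p) outs st'.
Proof.
move=> cp gt; have N0 := steps_until_gt0 cp gt.
have := @zero_time_steps _ _ _ _ _ a (steps_until a t).-1 p t outs st' cp.
rewrite prednK //; apply; last exact: steps_until_gt.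
exact: time_last_step cp gt.
Qed.

Lemma sent_received t p q m : correct a p -> gst a <= t ->
  sent a (steps_until a t) q p m -> received (at_time (t + delta) p) q m.
Proof.
move=> cp gt [j [jN /In_onth [k jk]]].
have [i [ei ti]] := delivery jk.
have := steps_valid a i; rewrite /valid_step ei => -[src [dst [m' [_]]]].
rewrite jk => -[<- <- <-] _ rc _.
apply: (@received_mono a i.+1) => //; last by rewrite rc; left.
rewrite ltn_steps_until; apply: le_trans ti _.
by rewrite lerD2r ge_max gt -ltn_steps_until jN.
Qed.

Lemma clockD p t u : gst a <= t -> 0 <= u -> clock a p (t + u) = clock a p t + u.
Proof.
move=> gt u0; rewrite (clock_no_drift p gt) (clock_no_drift (t := t + u) p).
  by ring.
by lra.
Qed.

Lemma vd_gt0 : 0 < view_duration.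
Proof. by rewrite /Defs.view_duration /Delta; lra_delays. Qed.

Lemma quad_at t u p s c : correct a p -> t <= u ->
  quad (at_time t p) = Some (s, c) -> exists s' c',
  [/\ quad (at_time u p) = Some (s', c'), sync_le s s' & core_le c c'].
Proof. by move=> cp /(steps_until_mono a) tu; apply: quad_some. Qed.

Lemma quad_at_le t u p s c s' c' : correct a p -> t <= u ->
  quad (at_time t p) = Some (s, c) -> quad (at_time u p) = Some (s', c') ->
  sync_le s s' /\ core_le c c'.
Proof. by move=> cp /(steps_until_mono a) tu; apply: quad_le. Qed.

Lemma pstep_timers x p clk inc (st st' : lstate) outs s' c' :
  pstep x p clk inc st outs st' -> quad st' = Some (s', c') ->
  (forall d, dissemination_timer s' = Some d -> d = clk + delta \/
     exists s c, quad st = Some (s, c) /\ dissemination_timer s = Some d) /\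
  (forall d, view_timer s' = Some d -> d = clk + view_duration \/
     exists s c, quad st = Some (s, c) /\ view_timer s = Some d).
Proof.
case=> {outs st'} /=; try by (intros; split=> d sd; right; exists s', c').
- by move=> ox c y _ _ _ _ [<- _]; split=> //= d [<-]; left.
- move=> s c s1 c1 outs _ sc H [<- _].
  have oldD d : dissemination_timer s = Some d -> exists s2 c2,
      quad st = Some (s2, c2) /\ dissemination_timer s2 = Some d.
    by exists s, c.
  have oldV d : view_timer s = Some d -> exists s2 c2,
      quad st = Some (s2, c2) /\ view_timer s2 = Some d.
    by exists s, c.
  inversion H; subst; split=> //= d;
    by [move=> /oldD; right | move=> /oldV; right | move=> [<-]; left].
- move=> s c c1 outs _ sc _ [<- _].
  by split=> d sd; right; exists s, c.
Qed.

(** Deadlines are set relative to the clock at some past step and clocks are monotone, so this also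
    holds for timers set before GST. The last step that leads to [conf a i p] is number [i.-1]. *)
Lemma timers_le i p s c t : correct a p -> quad (conf a i p) = Some (s, c) ->
  time a i.-1 <= t ->
  (forall d, dissemination_timer s = Some d -> d <= clock a p t + delta) /\
  (forall d, view_timer s = Some d -> d <= clock a p t + view_duration).
Proof.
move=> cp; elim: i s c => [|i IH] s c; first by rewrite conf0.
move=> sc it; have ct := clock_monotone a p it.
have ti : time a i.-1 <= t by apply: le_trans it; apply: time_mono; lia.
have [D W] := pstep_timers (executionP i cp) sc.
split=> d.
  move=> /D [->|[s0 [c0 [q0 d0]]]]; first by rewrite lerD2r.
  by have [H _] := IH _ _ q0 ti; apply: H.
move=> /W [->|[s0 [c0 [q0 d0]]]]; first by rewrite lerD2r.
by have [_ H] := IH _ _ q0 ti; apply: H.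
Qed.

Lemma quiescent_timers t p s c : correct a p -> gst a <= t ->
  quad (at_time t p) = Some (s, c) ->
  ~ expired (dissemination_timer s) (clock a p t) /\
  ~ expired (view_timer s) (clock a p t).
Proof.
move=> cp gt sc; split=> E.
  by apply: quiescent cp gt (Quad_sync sc (DisseminationTimer _ _ _ _ _ E)).
case: (ltnP (view s) f.+1) => vf.
  exact: quiescent cp gt (Quad_sync sc (ViewTimer_next _ _ _ _ _ E vf)).
exact: quiescent cp gt (Quad_sync sc (ViewTimer_last _ _ _ _ _ E vf)).
Qed.

(** In a fixed epoch the timer is never set again, so one that is still set at [t + delta] was set
    at [t] already and would have expired. *)
Lemma dissemination_done t p s c s' c' : correct a p -> gst a <= t ->
  quad (at_time t p) = Some (s, c) ->
  quad (at_time (t + delta) p) = Some (s', c') -> epoch s = epoch s' ->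
  dissemination_timer s' = None.
Proof.
move=> cp gt sc sc' ee; have td : t <= t + delta by lra_delays.
have [[_ /(_ ee) [D _]] _] := quad_at_le cp td sc sc'.
case: D => // D; case E: (dissemination_timer s') => [d|//].
have [] := quiescent_timers cp (le_trans gt td) sc'; rewrite E => -[] /=.
rewrite clockD //; last lra_delays.
have [H _] := timers_le cp sc (time_last_step cp gt).
by apply: H; rewrite -D.
Qed.

(** During each [view_duration] the present deadline passes, so the view grows unless the timer has
    been cleared, which in this epoch happens only at the end of the last view. *)
Lemma view_progress m t p s c s' c' : correct a p -> gst a <= t ->
  quad (at_time t p) = Some (s, c) -> dissemination_timer s = None ->
  quad (at_time (t + m%:R * view_duration) p) = Some (s', c') ->
  epoch s = epoch s' ->
  dissemination_timer s' = None /\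
  (view_timer s' = None \/ (view s + m <= view s')%N).
Proof.
move=> cp gt sc sN; have vd0 := vd_gt0.
elim: m s' c' => [|m IH] s' c' sc' ee.
  by move: sc'; rewrite mul0r addr0 sc addn0 => -[<- _]; split=> //; right.
have m0 : 0 <= m%:R * view_duration by apply: mulr_ge0; rewrite ?ler0n ?ltW.
have t1 : t <= t + m%:R * view_duration by lra_delays.
have tE : t + m.+1%:R * view_duration = t + m%:R * view_duration + view_duration.
  by rewrite -natr1; ring.
have t2 : t + m%:R * view_duration <= t + m.+1%:R * view_duration by lra_delays.
have [s1 [c1 [sc1 le01 _]]] := quad_at cp t1 sc.
have [le12 _] := quad_at_le cp t2 sc1 sc'.
have ee1 : epoch s = epoch s1 by case: le01 le12 => + _ [+ _]; lia.
have [d1 H1] := IH _ _ sc1 ee1.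
have [|D V1] := le12.2; first by rewrite -ee1.
split; first by case: D => ->.
case: (V1 d1) => [[vv n1]|[vv w1]].
  by case: H1 => // H1; right; lia.
case: H1 => H1; first by left; case: w1 => ->.
case: w1 => [w1|]; last by left.
case E: (view_timer s') => [d|]; last by left.
have gt' : gst a <= t + m.+1%:R * view_duration by lra_delays.
have [_] := quiescent_timers cp gt' sc'; rewrite E => -[] /=.
rewrite tE clockD ?(le_trans gt t1) ?(ltW vd0) //.
have [_ H] := timers_le cp sc1 (time_last_step cp (le_trans gt t1)).
by apply: H; rewrite -w1.
Qed.

Lemma exit_spread t p q : correct a p -> correct a q -> gst a <= t ->
  quad (at_time t p) <> None -> quad (at_time (t + delta) q) <> None.
Proof.
move=> cp cq gt qp qN; have td : gst a <= t + delta by lra_delays.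
have [_ _ _ /(_ qp) [ox [c [y [ev H]]]]] := conf_history (steps_until a t) cp.
have rq := sent_received cq gt (H q).
exact: quiescent cq td (Cert_relay _ (started_at cq td) qN rq (Exit delta eps _ _ ev)).
Qed.

Lemma epoch_spread t p q s c s' c' : correct a p -> correct a q -> gst a <= t ->
  quad (at_time t p) = Some (s, c) -> dissemination_timer s = None ->
  quad (at_time (t + delta) q) = Some (s', c') -> (epoch s <= epoch s')%N.
Proof.
move=> cp cq gt sc sN sc'; rewrite leqNgt; apply/negP => ee.
have td : gst a <= t + delta by lra_delays.
have [_ [e0 _ _ _ _] _] := conf_wfP cq sc'.
have [_ _ /(_ _ _ sc) [[H _] _] _] := conf_history (steps_until a t) cp.
have e1 : (1 < epoch s)%N by lia.
have rq := sent_received cq gt (H e1 sN q).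
exact: quiescent cq td (Quad_sync sc' (Epoch_entered _ _ _ _ _ ee rq)).
Qed.

Lemma completion_spread t q e : correct a q -> gst a <= t ->
  (forall p, correct a p -> exists s c, [/\ quad (at_time t p) = Some (s, c),
     epoch s = e, dissemination_timer s = None & view_timer s = None]) ->
  exists s c, quad (at_time (t + delta) q) = Some (s, c) /\ (e < epoch s)%N.
Proof.
move=> cq gt H; have td : t <= t + delta by lra_delays.
have [s0 [c0 [sc0 _ _ _]]] := H q cq.
have [s [c [sc _ _]]] := quad_at cq td sc0; exists s, c; split=> //.
rewrite ltnNge; apply/negP => ee.
have Q : at_least (2 * f).+1 (fun p => received (at_time (t + delta) q) p
    (EpochCompleted e (PSig TwoFPlusOne p (CEpoch V e)))).
  apply: (at_least_all_correct (a := a)) => p cp.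
  have [sp [k [spk <- dN vN]]] := H p cp.
  have [_ _ /(_ _ _ spk) [[_ K] _] _] := conf_history (steps_until a t) cp.
  exact: sent_received cq gt (K dN vN q).
exact: quiescent cq (le_trans gt td) (Quad_sync sc (Epoch_completed _ _ _ _ _ ee Q)).
Qed.

(* Either some correct process has exited by [gst + delta], and its CERTIFICATE
   makes the others exit, or all have sent ALLOW-ANY by then. *)
Lemma all_exit p t : correct a p -> gst a + 2 * delta <= t ->
  quad (at_time t p) <> None.
Proof.
suff H : forall p, correct a p -> quad (at_time (gst a + delta + delta) p) <> None.
  move=> cp t2; have := H p cp; case E: (quad _) => [[s c]|] // _.
  have t1 : gst a + delta + delta <= t by lra_delays.
  by have [s' [c' [->]]] := quad_at cp t1 E.
have g1 : gst a <= gst a + delta by lra_delays.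
have g2 : gst a <= gst a + delta + delta by lra_delays.
move=> {t p} p cp; case: (EM (exists q, correct a q /\ quad (at_time (gst a + delta) q) <> None)).
  by case=> q [cq qq]; apply: exit_spread cq cp g1 qq.
move=> none qN.
have stay q : correct a q -> quad (at_time (gst a + delta) q) = None.
  by move=> cq; apply: contrapT => qq; apply: none; exists q.
have dis q r : correct a q -> correct a r ->
    disclosed (at_time (gst a + delta) q) (input a r) r.
  move=> cq cr; apply: sent_received => //.
  have [S _ _ _] := conf_history (steps_until a (gst a)) cr.
  exact: S (started_at cr (lexx _)) q.
have allow q : correct a q -> allow_any_sent (at_time (gst a + delta) q).
  move=> cq; apply: contrapT => /negP na.
  case: (EM (exists x, at_least f.+1 (disclosed (at_time (gst a + delta) q) x))).
    case=> x D; apply: (quiescent cq g1 (Cert_values _ (started_at cq g1)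
      (stay q cq) D (Exit delta eps _ _ _))).
    by split; [right|].
  move=> nD; apply: (quiescent cq g1 (Cert_allow_any _ _ _ _ (started_at cq g1)
    (stay q cq) na _ _)).
    by apply: (at_least_all_correct (a := a)) => r cr; exists (input a r); apply: dis.
  by move=> x D; apply: nD; exists x.
have A : at_least f.+1 (fun q => received (at_time (gst a + delta + delta) p) q
    (AllowAny (PSig FPlusOne q (CAny V)))).
  have [B [cB BP]] : at_least (2 * f).+1 (fun q => received (at_time (gst a + delta + delta) p) q
      (AllowAny (PSig FPlusOne q (CAny V)))).
    apply: (at_least_all_correct (a := a)) => q cq; apply: sent_received => //.
    have [_ S _ _] := conf_history (steps_until a (gst a + delta)) cq.
    exact: S (allow q cq) p.
  by exists B; split=> //; lia.
apply: (quiescent cp g2 (Cert_any _ (started_at cp g2) qN A (Exit delta eps _ _ _))).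
by [].
Unshelve.
(* A certificate for bottom leaves the proposal open; the process's own input serves. *)
exact: (input a p).
Qed.

End Timing.

(** * Entering an epoch together *)

(** The value 0 before Quad starts makes the start of Quad an entry into epoch 1, so that the first
    epoch needs little special treatment. *)
Definition epoch_of (st : lstate) : nat := if quad st is Some (s, _) then epoch s else 0.

Lemma epoch_of_quad st s c : quad st = Some (s, c) -> epoch_of st = epoch s.
Proof. by rewrite /epoch_of => ->. Qed.

Lemma epoch_of_gt0 st : (0 < epoch_of st)%N -> exists s c, quad st = Some (s, c).
Proof. by rewrite /epoch_of; case: (quad st) => [[s c]|] // _; exists s, c. Qed.

Section Epochs.

Variable a : execution.

Local Notation at_time := (at_time a).

Lemma epoch_of_mono i j p : correct a p -> (i <= j)%N ->
  (epoch_of (conf a i p) <= epoch_of (conf a j p))%N.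
Proof.
move=> cp ij; rewrite {1}/epoch_of; case E: (quad _) => [[s c]|//].
by have [s' [c' [/epoch_of_quad -> [] ]]] := quad_some cp ij E.
Qed.

Lemma epoch_of_at_mono t u p : correct a p -> t <= u ->
  (epoch_of (at_time t p) <= epoch_of (at_time u p))%N.
Proof. by move=> cp /(steps_until_mono a); apply: epoch_of_mono. Qed.

(** Turns a clock difference into real time. Nothing places [u] after GST; monotonicity of the clock
    and [0 < x] exclude [u <= t]. *)
Lemma clock_lower p (t u x : R) : gst a <= t -> 0 < x ->
  clock a p t + x <= clock a p u -> t + x <= u.
Proof.
move=> gt x0 cu; rewrite leNgt; apply/negP => ut.
case: (leP u t) => tu; first by have := clock_monotone a p tu; lra.
move: cu; have -> : u = t + (u - t) by ring.
by rewrite clockD; lra.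
Qed.

Definition completes (e j : nat) (q : proc) : Prop :=
  exists s c, [/\ quad (conf a j q) = Some (s, c), epoch s = e,
    expired (view_timer s) (clock a q (time a j)) & (f.+1 <= view s)%N].

Lemma epoch_completes i p e : correct a p -> epoch_of (conf a i p) = e.+1 ->
  (0 < e)%N -> exists q j, [/\ correct a q, (j < i)%N & completes e j q].
Proof.
move=> cp; rewrite /epoch_of; case E: (quad _) => [[s c]|//] es e0.
have [_ [_ _ _ _ sg] _] := conf_wfP cp E.
have /(quorum_correct a) [q [cq /(_ cq) /(produced_signs cq) [j [ji H]]]] :
    supported a i (TSig TwoFPlusOne (CEpoch V e)).
  apply: has_tsig_supported cp _; exists s, c; split=> //; apply: Or41.
  by rewrite sg es.
by inversion H as [| |s' c' q' ex fv|]; subst; exists q, j; split=> //; exists s', c'.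
Qed.

(* When the first correct process enters [E] at step [j1], the first view of [E]
   starts [delta] later, except that the first epoch has no dissemination. *)
Definition epoch_start (E j1 : nat) : R :=
  if (E == 1)%N then time a j1 else time a j1 + delta.

Section Epoch.

Variables (E j1 : nat).
Hypothesis E_gt0 : (0 < E)%N.
Hypothesis before_j1 : forall i p, correct a p -> (i <= j1)%N ->
  (epoch_of (conf a i p) < E)%N.
Hypothesis gst_j1 : gst a < time a j1.

Local Notation A := (epoch_start E j1).

Lemma gst_A : gst a < A.
Proof. by rewrite /epoch_start; case: ifP => _; move: gst_j1; lra_delays. Qed.

(** A process in epoch [E] is never ahead of one that starts the first view at clock reading [K] and
    spends a full [view_duration] in each view. *)
Definition entered_after (K clk : R) (st : lstate) : Prop :=
  forall s c, quad st = Some (s, c) -> epoch s = E ->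
    (forall d, dissemination_timer s = Some d -> K <= d) /\
    (dissemination_timer s = None ->
       (forall d, view_timer s = Some d -> K + (view s)%:R * view_duration <= d) /\
       K + (view s).-1%:R * view_duration <= clk).

Lemma pstep_entered_after x p clk clk0 inc (st st' : lstate) outs K : wf st ->
  pstep x p clk inc st outs st' -> clk0 <= clk ->
  (epoch_of st' = E -> K <= if (E == 1)%N then clk else clk + delta) ->
  entered_after K clk0 st -> entered_after K clk st'.
Proof.
move=> w H cc KE I.
have {I} I : entered_after K clk st.
  move=> s c sc /(I _ _ sc) [I1 I2]; split=> // /I2 [I3 I4]; split=> //.
  exact: le_trans cc.
case: H w KE => {outs st'} //.
- move=> ox c y sst qN _ _ core _ KE s c' /= [<- _] /= E1.
  move: KE; rewrite /epoch_of /= => /(_ E1); rewrite -E1 /= => Kc.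
  split=> // _; split; last by rewrite mul0r addr0.
  by move=> d [<-]; rewrite mul1r lerD2r.
- move=> s c s' c' outs sst sc H; rewrite /wf sc => -[_ [e0 v0 N S _] _].
  move=> KE s0 c0 /= [<- _]; move: KE; rewrite /epoch_of /= => KE {s0 c0} ee.
  have vd0 := vd_gt0.
  have {}KE := KE ee; inversion H; subst.
  + have ex : expired (view_timer s) clk by [].
    have [I1 I2] := I _ _ sc ee; split=> //= dN.
    have [I3 I4] := I2 dN; move: ex; case vt: (view_timer s) => [d|//] /= dc.
    have := I3 _ vt => Kd; split; last lra.
    by move=> _ [<-]; rewrite -natr1 mulrDl mul1r addrA lerD2r; lra.
  + by have [I1 I2] := I _ _ sc ee; split=> //= /I2 [_ I4].
  + split=> //= d [<-]; move: KE; case: eqP => // E1.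
    by move: ee e0 => /=; lia.
  + split=> //= d [<-]; move: KE; case: eqP => // E1.
    by move: ee e0 => /=; lia.
  + have ex : expired (dissemination_timer s) clk by [].
    have [I1 _] := I _ _ sc ee; split=> //= _.
    move: ex; case dt: (dissemination_timer s) => [d|//] /= dc.
    have Kd := I1 _ dt; split; last by rewrite mul0r addr0; lra.
    by move=> _ [<-]; rewrite mul1r lerD2r; lra.
- move=> s c c' outs _ sc _ _ _ s0 c0 /= [<- _]; exact: I sc.
Qed.

Lemma conf_entered_after i p : correct a p ->
  entered_after (clock a p A) (clock a p (time a i.-1)) (conf a i p).
Proof.
move=> cp; elim: i => [|i IH]; first by move=> s c; rewrite conf0.
apply: pstep_entered_after (conf_wf i cp) (executionP i cp) _ _ IH.
  by apply: clock_monotone; apply: time_mono; lia.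
move=> ee; have ji : (j1 <= i)%N.
  by rewrite leqNgt; apply/negP => /(before_j1 cp); rewrite ee ltnn.
have := clock_monotone a p (time_mono a ji).
have := gst_j1; rewrite /epoch_start; case: ifP => // _ gj.
by rewrite clockD; lra_delays.
Qed.

Lemma completes_after j q : correct a q -> completes E j q ->
  A + f.+1%:R * view_duration <= time a j.
Proof.
move=> cq [s [c [sc es ex fv]]]; have vd0 := vd_gt0.
have [_ [e0 v0 N S _] _] := conf_wfP cq sc.
have dN : dissemination_timer s = None.
  case dt: (dissemination_timer s) => [d|//].
  have [|vN] := S; first by rewrite dt.
  by rewrite vN in ex.
have [_ /(_ dN) [H _]] := conf_entered_after cq sc es.
move: ex; case vt: (view_timer s) => [d|//] /= dc.
have {}H := H _ vt.
apply: clock_lower (ltW gst_A) _ _; first by apply: mulr_gt0; rewrite ?ltr0n.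
have vf : view s = f.+1 by lia.
by move: H; rewrite vf; apply: (fun x y => le_trans y x).
Qed.

(** Processes may skip epochs, so [p] itself need not have run [E]. But the signature that opens an
    epoch beyond [E] comes from a correct process in the preceding epoch at an earlier step, and
    this descent ends at one that completes [E]. *)
Lemma next_epoch_after i p : correct a p -> (E < epoch_of (conf a i p))%N ->
  exists j, (j < i)%N /\ A + f.+1%:R * view_duration <= time a j.
Proof.
elim/ltn_ind: i p => i IH p cp; case ee: (epoch_of _) => [//|e] Ee.
have [|q [j [cq ji cj]]] := epoch_completes cp ee; first lia.
move: Ee; rewrite ltnS leq_eqVlt => /predU1P[Ee|Ee].
  by exists j; split=> //; apply: completes_after cq _; rewrite Ee.
have [s [c [sc es _ _]]] := cj.
have [|k [kj H]] := IH j ji q cq; first by rewrite (epoch_of_quad sc) es.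
by exists k; split=> //; apply: ltn_trans ji.
Qed.

Lemma epoch_of_at_le t p : correct a p -> t < A + f.+1%:R * view_duration ->
  (epoch_of (at_time t p) <= E)%N.
Proof.
move=> cp tA; rewrite leqNgt; apply/negP => /(next_epoch_after cp) [j []].
by rewrite ltn_steps_until; lra.
Qed.

Lemma view_le k t p s c : correct a p -> (0 < k)%N -> gst a <= t ->
  t < A + k%:R * view_duration -> quad (at_time t p) = Some (s, c) ->
  epoch s = E -> dissemination_timer s = None -> (view s <= k)%N.
Proof.
move=> cp k0 gt tA sc es dN; have vd0 := vd_gt0.
rewrite leqNgt; apply/negP => kv.
have [_ /(_ dN) [_ H]] := conf_entered_after cp sc es.
have v0 : 0 < (view s).-1%:R * view_duration.
  by apply: mulr_gt0 => //; rewrite ltr0n; lia.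
have := clock_lower (ltW gst_A) v0 H.
have := time_last_step cp gt.
have : k%:R * view_duration <= (view s).-1%:R * view_duration.
  by rewrite ler_pM2r // ler_nat; lia.
by lra.
Qed.

Variable p1 : proc.
Hypotheses (correct_p1 : correct a p1) (p1_enters : (E <= epoch_of (conf a j1.+1 p1))%N).

Lemma short_time (x : R) : x <= 10%:R * delta -> A + x < A + f.+1%:R * view_duration.
Proof.
move=> x10; rewrite ltrD2l; apply: le_lt_trans x10 _.
have vd0 := vd_gt0.
have : view_duration <= f.+1%:R * view_duration.
  by rewrite ler_peMl ?ler1n //; lra.
by rewrite {1}/Defs.view_duration /Delta; lra_delays.
Qed.

(** For [E > 1], [p1] has disseminated by [A], its ENTER-EPOCH message arrives by [A + delta], and
    the receiver's own dissemination takes another [delta]. For [E = 1] the relayed certificate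
    plays the part of ENTER-EPOCH, and there is no dissemination. *)
Lemma all_enter q : correct a q -> exists s c,
  [/\ quad (at_time (A + 2 * delta) q) = Some (s, c), epoch s = E &
      dissemination_timer s = None].
Proof.
move=> cq; have A2 : A + 2 * delta < A + f.+1%:R * view_duration.
  by apply: short_time; lra_delays.
have gA := gst_A.
have gj : gst a <= time a j1 by apply: ltW.
have p1E : (E <= epoch_of (at_time (time a j1) p1))%N.
  apply: leq_trans p1_enters _; apply: epoch_of_mono => //.
  by rewrite ltn_steps_until.
have [s1 [c1 sc1]] : exists s c, quad (at_time (time a j1) p1) = Some (s, c).
  by apply: epoch_of_gt0; lia_nat.
have up t p s c : correct a p -> t <= A + 2 * delta ->
    quad (at_time t p) = Some (s, c) -> (epoch s <= E)%N.
  by move=> cp tA sc; rewrite -(epoch_of_quad sc) epoch_of_at_le //; lra_delays.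
rewrite (epoch_of_quad sc1) in p1E.
case: (eqVneq E 1%N) => E1.
  have AE : A = time a j1 by rewrite /epoch_start E1.
  have tA : time a j1 + delta <= A + 2 * delta by lra_delays.
  have : quad (at_time (time a j1 + delta) q) <> None.
    by apply: exit_spread correct_p1 cq gj _ => //; rewrite sc1.
  case sc0: (quad _) => [[s0 c0]|] // _.
  have [s [c [sc [ee _] _]]] := quad_at cq tA sc0.
  exists s, c; have [_ [e0 _ N S _] _] := conf_wfP cq sc.
  have eE := up _ _ _ _ cq (lexx _) sc.
  split=> //; first lia_nat.
  case dt: (dissemination_timer s) => [d|//].
  by have [|_ _] := S; [rewrite dt | lia_nat].
have AE : A = time a j1 + delta by rewrite /epoch_start (negPf E1).
have jA : time a j1 <= A by lra_delays.
have jA2 : time a j1 <= A + 2 * delta by lra_delays.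
have A12 : A + delta <= A + 2 * delta by lra_delays.
have [s2 [c2 [sc2 [e12 _] _]]] := quad_at correct_p1 jA sc1.
have e1E := up _ _ _ _ correct_p1 jA2 sc1.
have AA2 : A <= A + 2 * delta by lra_delays.
have e2E := up _ _ _ _ correct_p1 AA2 sc2.
have d2 : dissemination_timer s2 = None.
  rewrite AE in sc2; have ee : epoch s1 = epoch s2.
    by lia_nat.
  exact: (dissemination_done correct_p1 gj sc1 sc2 ee).
have : quad (at_time (A + delta) q) <> None.
  by apply: all_exit => //; move: gst_j1; lra_delays.
case sc3: (quad _) => [[s3 c3]|] // _.
have e3 := epoch_spread correct_p1 cq (ltW gA) sc2 d2 sc3.
have e3E := up _ _ _ _ cq A12 sc3.
have [s [c [sc [e34 _] _]]] := quad_at cq A12 sc3.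
have e4E := up _ _ _ _ cq (lexx _) sc.
have ep2 : (E <= epoch s2)%N by apply: leq_trans e12.
exists s, c; split; [exact: sc | lia_nat |].
have A2E : A + 2 * delta = A + delta + delta by ring.
rewrite A2E in sc; have gA1 : gst a <= A + delta by lra_delays.
have e34' : epoch s3 = epoch s by lia_nat.
exact: (dissemination_done cq gA1 sc3 sc e34').
Qed.

(** The lower bound on [t] lets the slowest process reach view [k]; the upper bound is the earliest
    time at which the fastest can leave it. *)
Lemma in_view k t q : correct a q -> (0 < k <= f.+1)%N ->
  A + 2 * delta + k.-1%:R * view_duration <= t ->
  t < A + k%:R * view_duration ->
  exists s c, quad (at_time t q) = Some (s, c) /\ cur c = gv E k.
Proof.
move=> cq /andP[k0 kf] kt tA; have vd0 := vd_gt0.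
have gA := gst_A.
have k1 : 0 <= k.-1%:R * view_duration by apply: mulr_ge0; rewrite ?ler0n ?ltW.
have kf' : k%:R * view_duration <= f.+1%:R * view_duration.
  by rewrite ler_pM2r // ler_nat.
have up u s c : u <= t -> quad (at_time u q) = Some (s, c) -> (epoch s <= E)%N.
  by move=> ut sc; rewrite -(epoch_of_quad sc) epoch_of_at_le //; lra.
have [s0 [c0 [sc0 e0 d0]]] := all_enter cq.
have u01 : A + 2 * delta <= A + 2 * delta + k.-1%:R * view_duration by lra.
have [s1 [c1 [sc1 [e01 _] _]]] := quad_at cq u01 sc0.
have e1 := up _ _ _ kt sc1.
have gA2 : gst a <= A + 2 * delta by lra_delays.
have [d1 v1] : dissemination_timer s1 = None /\
    (view_timer s1 = None \/ (view s0 + k.-1 <= view s1)%N).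
  by apply: (view_progress cq gA2 sc0 d0 sc1); lia_nat.
have {}v1 : (k <= view s1)%N.
  have [_ [_ v0 _ _ _] _] := conf_wfP cq sc0.
  (* If the view timer is off, [q] has already signed the completion of [E], which [completes_after]
     excludes this early. *)
  case: v1 => v1; last lia_nat.
  have [_ _ /(_ _ _ sc1) [[_ H] _] _] := conf_history (steps_until a
     (A + 2 * delta + k.-1%:R * view_duration)) cq.
  have [j [jN Hj]] := H d1 v1 q.
  have pr : produced_before a (steps_until a (A + 2 * delta + k.-1%:R * view_duration))
     (PSig TwoFPlusOne q (CEpoch V (epoch s1))).
    by exists j, q; eexists; split; [exact: jN | exact: Hj | left].
  have [i [iN Hi]] := produced_signs cq pr.
  inversion Hi as [| |s' c' q' ex fv ee|].
  have : A + f.+1%:R * view_duration <= time a i.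
    by apply: completes_after cq _; exists s', c'; split=> //; lia_nat.
  by move: iN; rewrite ltn_steps_until; lra.
have [s [c [sc le _]]] := quad_at cq kt sc1; exists s, c; split; first exact: sc.
have e2 := up _ _ _ (lexx _) sc.
have ee : epoch s1 = epoch s by case: le; lia_nat.
have [_ /(_ ee) [D W]] := le.
have dN : dissemination_timer s = None by case: D => ->.
have vk : (view s <= k)%N.
  by apply: (view_le cq k0 _ tA sc) => //; [lra | case: le; lia_nat].
have [_ [_ _ N _ _] _] := conf_wfP cq sc.
rewrite N //; congr gv; first by case: le; lia_nat.
by case: (W d1) => [[]|[]]; lia_nat.
Qed.

End Epoch.

End Epochs.

(** * Reaching a fresh epoch after GST *)

Section Synchronization.

Variable a : execution.

Local Notation at_time := (at_time a).

Definition max_epoch (t : R) : nat := (\max_(p | correct a p) epoch_of (at_time t p))%N.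

Lemma max_epoch_le t p : correct a p -> (epoch_of (at_time t p) <= max_epoch t)%N.
Proof. by move=> cp; apply: (@leq_bigmax_cond _ (correct a) (fun p => epoch_of (at_time t p))). Qed.

Lemma max_epoch_attained t : exists p, correct a p /\ epoch_of (at_time t p) = max_epoch t.
Proof.
have [p0 cp0] := exists_correct a.
have [|p cp E] := @eq_bigmax_cond _ (correct a) (fun p => epoch_of (at_time t p)).
  by apply/card_gt0P; exists p0.
by exists p.
Qed.

Lemma epoch_of_exit p t : correct a p -> gst a + 2 * delta <= t ->
  exists s c, quad (at_time t p) = Some (s, c).
Proof.
move=> cp /(all_exit cp).
by case E: (quad _) => [[s c]|] // _; exists s, c.
Qed.

(** A process in the maximal epoch at GST disseminates it by [gst + delta]. The hypothesis prevents
    a still later epoch from cancelling its dissemination timer first. *)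
Lemma epochs_meet : (forall p, correct a p ->
    (epoch_of (at_time (gst a + delta) p) <= max_epoch (gst a))%N) ->
  forall p, correct a p ->
    (max_epoch (gst a) <= epoch_of (at_time (gst a + 2 * delta) p))%N.
Proof.
move=> up p cp; have [q [cq eq]] := max_epoch_attained (gst a).
case: (posnP (max_epoch (gst a))) => [-> //|m0].
have [|s0 [c0 sc0]] := @epoch_of_gt0 (at_time (gst a) q); first by rewrite eq.
have g1 : gst a <= gst a + delta by lra_delays.
have g2 : gst a + 2 * delta = gst a + delta + delta by ring.
have [s1 [c1 [sc1 [e01 _] _]]] := quad_at cq g1 sc0.
have := up q cq; rewrite (epoch_of_quad sc1) => up1.
rewrite (epoch_of_quad sc0) in eq.
have ee : epoch s0 = epoch s1 by lia_nat.
have d1 := dissemination_done cq (lexx _) sc0 sc1 ee.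
have [s [c sc]] := epoch_of_exit cp (lexx (gst a + 2 * delta)).
rewrite (epoch_of_quad sc) -eq ee.
apply: (epoch_spread cq cp g1 sc1 d1); rewrite -g2; exact: sc.
Qed.

(** Otherwise all are in the maximal epoch by [2 * delta] after GST and have disseminated by
    [3 * delta]; all its views are over [f.+1] durations later, and EPOCH-COMPLETED takes the fourth
    [delta]. *)
Lemma next_epoch_reached : exists p, correct a p /\
  (max_epoch (gst a) <
     epoch_of (at_time (gst a + 4 * delta + f.+1%:R * view_duration) p))%N.
Proof.
apply: contrapT => none.
have vd0 := vd_gt0.
have fv0 : 0 <= f.+1%:R * view_duration by apply: mulr_ge0; rewrite ?ler0n ?ltW.
pose T := gst a + 4 * delta + f.+1%:R * view_duration.
have up t p : t <= T -> correct a p -> (epoch_of (at_time t p) <= max_epoch (gst a))%N.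
  move=> tT cp; apply: leq_trans (epoch_of_at_mono cp tT) _.
  by rewrite leqNgt; apply/negP => H; apply: none; exists p.
have [p0 cp0] := exists_correct a.
have g2 : gst a + 2 * delta <= gst a + 3 * delta by lra_delays.
have low p : correct a p -> (max_epoch (gst a) <= epoch_of (at_time (gst a + 2 * delta) p))%N.
  by apply: epochs_meet => q cq; apply: up => //; rewrite /T; lra_delays.
have st p t : correct a p -> gst a + 2 * delta <= t -> t <= T ->
    exists s c, quad (at_time t p) = Some (s, c) /\ epoch s = max_epoch (gst a).
  move=> cp gt tT; have [s [c sc]] := epoch_of_exit cp gt; exists s, c; split=> //.
  have := up _ _ tT cp; have := low p cp; have := epoch_of_at_mono cp gt.
  by rewrite (epoch_of_quad sc); lia_nat.
have T3 : gst a + 3 * delta = gst a + 2 * delta + delta by ring.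
pose u := gst a + 3 * delta + f.+1%:R * view_duration.
have uT : T = u + delta by rewrite /T /u; ring.
have gu : gst a <= u by rewrite /u; lra_delays.
have gu2 : gst a + 2 * delta <= u by rewrite /u; lra_delays.
have uT' : u <= T by rewrite uT; lra_delays.
have all_done p : correct a p -> exists s c, [/\ quad (at_time u p) = Some (s, c),
     epoch s = max_epoch (gst a), dissemination_timer s = None & view_timer s = None].
  move=> cp.
  have h2 : gst a + 2 * delta <= T by rewrite /T; lra_delays.
  have h3 : gst a + 3 * delta <= T by rewrite /T; lra_delays.
  have [s2 [c2 [sc2 e2]]] := st p _ cp (lexx _) h2.
  have [s3 [c3 [sc3 e3]]] := st p _ cp g2 h3.
  have [s [c [sc e]]] := st p _ cp gu2 uT'.
  have d3 : dissemination_timer s3 = None.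
    rewrite T3 in sc3; apply: (dissemination_done cp _ sc2 sc3).
      by lra_delays.
    by rewrite e2 e3.
  have g3 : gst a <= gst a + 3 * delta by lra_delays.
  have [|d v] := view_progress cp g3 sc3 d3 sc; first by rewrite e3 e.
  exists s, c; split=> //; case: v => // v.
  have [_ [_ v3 _ _ _] _] := conf_wfP cp sc3.
  by have [_ [_ vs _ _ _] _] := conf_wfP cp sc; lia_nat.
have [s [c [sc es]]] := completion_spread cp0 gu all_done.
have := up (u + delta) p0; rewrite -uT => /(_ (lexx _) cp0).
by rewrite uT (epoch_of_quad sc); lia_nat.
Qed.

Lemma first_entry : exists j p, [/\ correct a p,
  (max_epoch (gst a) < epoch_of (conf a j.+1 p))%N,
  forall i q, correct a q -> (i <= j)%N ->
    (epoch_of (conf a i q) < (max_epoch (gst a)).+1)%N,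
  gst a < time a j & time a j <= gst a + 4 * delta + f.+1%:R * view_duration].
Proof.
have [p0 [cp0 H0]] := next_epoch_reached.
set T := gst a + 4 * delta + f.+1%:R * view_duration in H0 *; set e := max_epoch (gst a) in H0 *.
pose enters i := `[< exists p, correct a p /\ (e < epoch_of (conf a i p))%N >].
have ex : exists i, enters i by exists (steps_until a T); apply/asboolP; exists p0.
have [i /asboolP [p [cp ep]] imin] := ex_minnP ex.
case: i ep imin => [|j] ep imin; first by rewrite conf0 in ep.
exists j, p; split=> //.
- move=> i q cq ij; rewrite ltnS leqNgt; apply/negP => H.
  suff : (j < i)%N by rewrite ltnNge ij.
  by apply: imin; apply/asboolP; exists q.
- rewrite ltNge -ltn_steps_until; apply/negP => jg.
  have := epoch_of_mono cp jg; have := max_epoch_le (gst a) cp.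
  by rewrite -/e /at_time; lia.
- rewrite -ltn_steps_until; apply: imin.
  by apply/asboolP; exists p0.
Qed.

(** The 15 is [4 + 1 + 2 + 8]: first entry, dissemination, spread of entries, decision. One [f.+1]
    durations lead to the entry, the other bounds the views before the good one. The last two
    clauses limit the epochs that count for communication. *)
Lemma synchronization : exists E v T, [/\ correct a (leader f v), gst a <= T,
  T + 8 * delta <= gst a + 15 * delta + (2 * f.+1)%:R * view_duration,
  (forall p t, correct a p -> T <= t -> t <= T + 8 * delta ->
     exists s c, quad (at_time t p) = Some (s, c) /\ cur c = v) &
  (forall p t, correct a p -> t <= T + 8 * delta ->
     (epoch_of (at_time t p) <= E)%N) /\
  (forall p, correct a p -> exists s c,
     quad (at_time (gst a + 4 * delta) p) = Some (s, c) /\ (E <= (epoch s).+1)%N)].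
Proof.
have vd0 := vd_gt0.
have [j [p1 [cp1 ep1 before gj jT]]] := first_entry.
set e := max_epoch (gst a) in ep1 before.
have [k [kf ck]] := exists_correct_leader a (ltn0Sn e).
pose A := epoch_start a e.+1 j.
pose T := A + 2 * delta + k.-1%:R * view_duration.
have gA : gst a < A by apply: gst_A.
have Aj : A <= time a j + delta by rewrite /A /epoch_start; case: ifP => _; lra_delays.
have jA : time a j <= A by rewrite /A /epoch_start; case: ifP => _; lra_delays.
have k1 : 0 <= k.-1%:R * view_duration by apply: mulr_ge0; rewrite ?ler0n ?ltW.
have kE : k%:R * view_duration = k.-1%:R * view_duration + view_duration.
  by rewrite -[in LHS](prednK (proj1 (andP kf))) -natr1; ring.
have kf' : k%:R * view_duration <= f.+1%:R * view_duration.
  by rewrite ler_pM2r // ler_nat; case/andP: kf.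
have vdE : view_duration = 10 * delta + eps by rewrite /Defs.view_duration /Delta; ring.
have T8 : T + 8 * delta < A + k%:R * view_duration by rewrite kE /T; lra_delays.
have T8f : T + 8 * delta < A + f.+1%:R * view_duration by lra.
exists e.+1, (gv e.+1 k), T; split=> //.
- by rewrite /T; lra_delays.
- have -> : (2 * f.+1)%:R * view_duration = f.+1%:R * view_duration + f.+1%:R * view_duration :> R.
    by rewrite natrM; ring.
  rewrite /T; have : k.-1%:R * view_duration <= f.+1%:R * view_duration.
    by rewrite ler_pM2r // ler_nat; clear -kf; lia.
  by lra_delays.
- move=> p t cp Tt tT; apply: (in_view _ before gj cp1) => //.
  by apply: le_lt_trans T8.
split.
  move=> p t cp tT; apply: (epoch_of_at_le _ before gj) => //.
  by apply: le_lt_trans T8f.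
move=> p cp; have g4 : gst a + 2 * delta <= gst a + 4 * delta by lra_delays.
have [s [c sc]] := epoch_of_exit cp g4; exists s, c; split=> //; rewrite ltnS.
rewrite -(epoch_of_quad sc).
(* Either the new epoch is entered by [gst + delta], and all are in it [3 * delta] later, or
   [epochs_meet] applies and all have reached at least [e]. *)
case: (leP (time a j) (gst a + delta)) => tj.
  have [s0 [c0 [sc0 e0 _]]] := all_enter (ltn0Sn e) before gj cp1 ep1 cp.
  have A4 : A + 2 * delta <= gst a + 4 * delta by lra_delays.
  have := epoch_of_at_mono cp A4; rewrite (epoch_of_quad sc0) e0.
  exact: ltnW.
apply: leq_trans (epoch_of_at_mono cp g4); apply: epochs_meet => // q cq.
rewrite -ltnS; apply: before => //.
by rewrite leqNgt; apply/negP; rewrite ltn_steps_until; move: tj; lra.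
Qed.

End Synchronization.

(** * A synchronized view with a correct leader *)

(** Dates a VIEW-CHANGE message at the entry into its view, so that its QC can be compared with what
    the sender stored in earlier views. *)
Lemma pstep_view_change x p clk inc (st st' : lstate) outs d v oq : 
  pstep x p clk inc st outs st' -> List.In (d, ViewChange f v oq) outs ->
  exists s c, [/\ quad st' = Some (s, c), cur c = v & prepareQC c = oq].
Proof.
case=> {outs st'} //.
- by move=> _ /In_broadcast.
- by move=> _ _ _ _ _ /In_broadcast.
- move=> ox c y _ _ _ _ core /In_cat [/In_broadcast //|[[_ <- <-]|//]].
  by do 2 eexists; split.
- move=> s c s' c' outs _ sc H; inversion H; subst => //.
  + by move=> [[_ <- <-]|//]; do 2 eexists; split.
  + by move=> /In_broadcast.
  + by move=> /In_cat [/In_broadcast //|[[_ <- <-]|//]]; do 2 eexists; split.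
- move=> s c c' outs _ sc; case=> {c c' outs sc} //=.
  + by move=> c Q qcs h _ _ _ _ _ _ /In_broadcast.
  + move=> c y oq' outs _ _ _ _ sf usf oo.
    case: (EM (safe (cv_val y) oq' (lockedQC c))) => H.
      by move: oo; rewrite sf // => -[].
    by rewrite usf in oo.
  + by move=> c T y cert Q h _ _ _ _ _ /In_broadcast; case: T.
  + by move=> c q _ _ _ _ [].
  + by move=> c q _ _ _ _ [].
Qed.

Definition proposes (st : lstate) (v : nat) (y : cval V) (oq : option (qc V)) : Prop :=
  exists (Q : {set proc}) (qcs : proc -> option (qc V)) (h : proc),
  [/\ ((2 * f).+1 <= #|Q|)%N,
    forall q, q \in Q ->
      received st q (ViewChange f v (qcs q)) /\ (qc_rank (qcs q) <= qc_rank oq)%N,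
    valid_prepareQC oq, oq = qcs h &
    oq = None \/ qc_has_value oq (cv_val y)].

Lemma pstep_prepare_sent x p clk inc (st st' : lstate) outs d v y oq :
  pstep x p clk inc st outs st' -> List.In (d, Prepare f v y oq) outs ->
  exists s c c', [/\ quad st = Some (s, c), quad st' = Some (s, c'),
    cur c = v /\ cur c' = v, ~~ proposed c /\ proposed c' &
    outs = broadcast (Prepare f v y oq) /\ proposes st v y oq].
Proof.
case=> {outs st'} //.
- by move=> _ /In_broadcast.
- by move=> _ _ _ _ _ /In_broadcast.
- by move=> ox c z _ _ _ _ core /In_cat [/In_broadcast //|[|//]].
- move=> s c s' c' outs _ sc H; inversion H; subst => //.
  + by case.
  + by move=> /In_broadcast.
  + by move=> /In_cat [/In_broadcast //|[]].
- move=> s c c' outs _ sc H; case: H sc => {c c' outs} //=.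
  + move=> c Q qcs h _ np cQ rQ hQ mx sc /In_broadcast [-> -> ->].
    do 3 eexists; split; [exact: sc | by [] | by [] | by [] |].
    split=> //; exists Q, qcs, h; split=> //; last by case: (qcs h); [right | left].
      by move=> q qQ; split; [case: (rQ _ qQ) | apply: mx].
    by case: (rQ _ hQ).
  + move=> c z oq' outs _ _ _ _ sf usf _ oo.
    case: (EM (safe (cv_val z) oq' (lockedQC c))) => H.
      by move: oo; rewrite sf // => -[].
    by rewrite usf in oo.
  + by move=> c T z cert Q h _ _ _ _ _ _ /In_broadcast; case: T.
  + by move=> c q _ _ _ _ _ [].
  + by move=> c q _ _ _ _ _ [].
Qed.

Section Decision.

Variable a : execution.

Local Notation at_time := (at_time a).

Lemma prepare_unique p i j d d' v y y' oq oq' : correct a p ->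
  sent a i p d (Prepare f v y oq) -> sent a j p d' (Prepare f v y' oq') ->
  y = y' /\ oq = oq'.
Proof.
move=> cp [k [_ /In_sends /(pstep_prepare_sent (executionP k cp)) H1]].
move: H1 => [s1 [c1 [c1' [q1 q1' [cv cv'] [np1 p1] [o1 _]]]]].
move=> [l [_ /In_sends /(pstep_prepare_sent (executionP l cp)) H2]].
move: H2 => [s2 [c2 [c2' [q2 q2' [cw cw'] [np2 p2] [o2 _]]]]].
case: (ltngtP k l) => [kl|lk|kl].
- have [_ [_ F _ _ _]] := quad_le cp kl q1' q2.
  have [|_ H _ _] := F; first by rewrite cv' cw.
  by rewrite (H p1) in np2.
- have [_ [_ F _ _ _]] := quad_le cp lk q2' q1.
  have [|_ H _ _] := F; first by rewrite cw' cv.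
  by rewrite (H p2) in np1.
- subst l; have : List.In (p, Prepare f v y oq) (outs_of a k p).
    by rewrite o1; apply/In_broadcast.
  by rewrite o2 => /In_broadcast [<- <-].
Qed.

Section View.

Variable v : nat.
Local Notation l := (leader f v).
Hypothesis correct_leader : correct a l.

Lemma prepare_votes_agree p q i j x y : correct a p -> correct a q ->
  produced_before a i (PSig TwoFPlusOne p (CVote VPrepare x v)) ->
  produced_before a j (PSig TwoFPlusOne q (CVote VPrepare y v)) -> x = y.
Proof.
move=> cp cq /(vote_inv cp) H1 /(vote_inv cq) H2.
move: H1 => [k1 [s1 [c1 [c1' [y1 [_ _ _ [cv _] [<- _ _ _ [o1 [r1 _ _ _]]]]]]]]].
move: H2 => [k2 [s2 [c2 [c2' [y2 [_ _ _ [cw _] [<- _ _ _ [o2 [r2 _ _ _]]]]]]]]].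
move: r1 r2; rewrite cv cw => /(received_sent cp) r1 /(received_sent cq) r2.
by have [-> _] := prepare_unique correct_leader r1 r2.
Qed.

(** The leader needs [2f+1] votes for the same value and must not have to count on Byzantine ones.
    PREPARE votes answer the leader's only PREPARE; later votes answer valid QCs of one type and
    view, which have one value. *)
Lemma votes_agree T p q i j x y : correct a p -> correct a q ->
  produced_before a i (PSig TwoFPlusOne p (CVote T x v)) ->
  produced_before a j (PSig TwoFPlusOne q (CVote T y v)) -> x = y.
Proof.
case: T => cp cq; first exact: prepare_votes_agree.
all: move=> /(vote_inv cp) H1 /(vote_inv cq) H2.
all: move: H1 => [k1 [s1 [c1 [c1' [y1 [_ _ _ [cv _] [<- _ _ _ [o1 [r1 [_ _ v1] w1 <- _]]]]]]]]].
all: move: H2 => [k2 [s2 [c2 [c2' [y2 [_ _ _ [cw _] [<- _ _ _ [o2 [r2 [_ _ v2] w2 <- _]]]]]]]]].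
all: have := received_supported cp r1 (in_qc_sig o1).
all: have := received_supported cq r2 (in_qc_sig o2).
all: rewrite v1 v2 w1 w2 cv cw => S2 S1; exact: quorum_unique S1 S2.
Qed.

Lemma prepare_supported i x : supported a i (TSig TwoFPlusOne (CVote VPrepare x v)) ->
  exists k d y oq, cv_val y = x /\ sent a k l d (Prepare f v y oq).
Proof.
move=> /(quorum_correct a) [p [cp /(_ cp) /(vote_inv cp) H]].
move: H => [k [s [c [c' [y [_ _ _ [cv _] [yx _ _ _ [oq [r _ _ _]]]]]]]]].
by move: r; rewrite cv => /(received_sent cp) r; exists k, p, y, oq.
Qed.

(* The leader's [oq] is maximal among [2f+1] VIEW-CHANGE messages, one of which
   comes from a correct process that has helped to form the lock. *)
Lemma leader_safe j p s c y oq : correct a p ->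
  quad (conf a j p) = Some (s, c) -> cur c = v ->
  received (conf a j p) l (Prepare f v y oq) -> safe (cv_val y) oq (lockedQC c).
Proof.
move=> cp sc cv rp.
have [k [kj pk]] := received_sent cp rp.
move/In_sends: (pk) => /(pstep_prepare_sent (executionP k correct_leader)).
move=> [s1 [c1 [c1' [q1 q1' _ _ [_ [Q [qcs [h [cQ rQ vo oh oy]]]]]]]]].
split=> //; case lE: (lockedQC c) => [lq|]; last exact: Or31.
have sl := locked_supported cp sc lE.
have [_ _ [_ rl _ _ _]] := conf_wfP cp sc.
(* A lock obtained in [v] itself goes back to the leader's only PREPARE, so it has the value
   [cv_val y]. An older lock is compared with the VIEW-CHANGE messages. *)
move: rl; rewrite lE /= cv ltnS leq_eqVlt => /predU1P[wv|wv].
  apply: Or32; rewrite /= ; rewrite wv in sl.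
  have [j' [_ sl']] := precommit_supported sl.
  have [k' [d [y' [oq' [<- sk']]]]] := prepare_supported sl'.
  have sk : sent a k.+1 l p (Prepare f v y oq) by exists k.
  by have [-> _] := prepare_unique correct_leader sk' sk.
have [r [cr /(_ cr) Pr rr]] : exists r, [/\ correct a r, correct a r ->
    produced_before a j (PSig TwoFPlusOne r
      (CVote VPrecommit (cv_val (qc_value lq)) (qc_view lq))) &
    received (conf a k l) r (ViewChange f v (qcs r)) /\ (qc_rank (qcs r) <= qc_rank oq)%N].
  by apply: (quorum_cap a sl); exists Q.
have [i1 [u [e [e' [z [_ qe qe' [ew ew'] [zx _ _ _]]]]]]] := vote_inv cr Pr.
move=> [q0 [r0 [_ _ v0] w0 z0 pq0]].
have [rv rle] := rr.
have [i2 [_ /In_sends]] := received_sent correct_leader rv.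
move=> /(pstep_view_change (executionP i2 cr)) [u2 [e2 [qe2 e2v pe2]]].
have i12 : (i1 <= i2)%N.
  rewrite leqNgt; apply/negP => i21.
  by have [_ [le _ _ _ _]] := quad_le cr i21 qe2 qe; lia.
have [_ [_ _ le _ _]] := quad_le cr (i12 : (i1.+1 <= i2.+1)%N) qe' qe2.
move: le; rewrite pq0 pe2 /= w0 ew => le1.
have {le1 rle} : (qc_rank (Some lq) <= qc_rank oq)%N by apply: leq_trans rle.
(* Equal ranks mean PREPARE QCs of the same view, hence of the same value. *)
rewrite leq_eqVlt => /predU1P[eq|]; last exact: Or33.
apply: Or32; clear pk oh rQ rr; case: oq oy vo eq rp => [o|//] oy vo [eq] rp.
case: oy => [//|/= <-]; case: vo => _ _ vo.
have := received_supported cp rp; move/(_ (qc_sig o)) => so.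
have := so (or_intror (or_intror (or_introl erefl))); rewrite vo -eq => So.
have := received_supported cr r0 (in_qc_sig q0); rewrite v0 w0 ew z0 zx => S0.
exact: quorum_unique S0 So.
Qed.

Variable T : R.
Hypothesis gst_T : gst a <= T.
Hypothesis in_v : forall p t, correct a p -> T <= t -> t <= T + 8 * delta ->
  exists s c, quad (at_time t p) = Some (s, c) /\ cur c = v.

Lemma in_v_history t p : correct a p -> T <= t -> t <= T + 8 * delta ->
  exists s c, [/\ quad (at_time t p) = Some (s, c), cur c = v &
    core_history p c (fun d m => sent a (steps_until a t) p d m)].
Proof.
move=> cp Tt tT; have [s [c [sc cv]]] := in_v cp Tt tT; exists s, c; split=> //.
by have [_ _ /(_ _ _ sc) [_]] := conf_history (steps_until a t) cp.
Qed.

Lemma leader_proposes t : T <= t -> t + delta <= T + 8 * delta ->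
  exists y oq, [/\ certified y, valid_prepareQC oq &
    forall d, sent a (steps_until a (t + delta)) l d (Prepare f v y oq)].
Proof.
move=> Tt tT; have Tt' : T <= t + delta by lra_delays.
have gt : gst a <= t by apply: le_trans Tt.
have gt' : gst a <= t + delta by lra_delays.
have [s [c [sc cv [_ P _ _]]]] := in_v_history correct_leader Tt' tT.
case: (boolP (proposed c)) => [/P|np]; first by rewrite cv.
have [qcs Hq] : {qcs : proc -> option (qc V) & forall q, correct a q ->
    valid_prepareQC (qcs q) /\ received (at_time (t + delta) l) q (ViewChange f v (qcs q))}.
  apply: (@choice _ _ (fun q oq => correct a q -> valid_prepareQC oq /\
     received (at_time (t + delta) l) q (ViewChange f v oq))) => q.
  case: (boolP (correct a q)) => cq; last by exists None.
  have tT' : t <= T + 8 * delta by lra_delays.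
  have [s' [c' [sc' cv' [[oq [vo so]] _ _ _]]]] := in_v_history cq Tt tT'.
  exists oq => _; split=> //; rewrite cv' in so.
  exact: sent_received correct_leader gt so.
pose h := [arg max_(q > l | correct a q) qc_rank (qcs q)].
have [ch hmax] : correct a h /\ forall q, correct a q -> (qc_rank (qcs q) <= qc_rank (qcs h))%N.
  by rewrite /h; case: arg_maxnP => // h' ch' H; split.
exfalso; apply: (quiescent (p := l) correct_leader gt').
apply: (Quad_core _ _ _ sc); apply: (@Leader_prepare _ _ _ _ _ _ (~: byz a) qcs h) => //.
- by rewrite cv.
- by have := cardsC (byz a); have := byz_bound a; rewrite card_ord /nproc; clear; lia.
- by move=> q; rewrite inE => cq; have [vq rq] := Hq q cq; rewrite cv.
- by rewrite inE.
- by move=> q; rewrite inE => cq; apply: hmax.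
Qed.

(** The vote is stated for some [z], as [prepare_seen] may stem from an earlier step; that all votes
    have the same value is left to [votes_agree]. *)
Lemma replicas_vote t p y oq : correct a p -> T <= t -> t + delta <= T + 8 * delta ->
  certified y -> valid_prepareQC oq ->
  (forall d, sent a (steps_until a t) l d (Prepare f v y oq)) ->
  exists z, certified z /\ sent a (steps_until a (t + delta)) p l
    (Vote VPrepare v z (vote_sig p VPrepare (cv_val z) v)).
Proof.
move=> cp Tt tT cy vo sp; have Tt' : T <= t + delta by lra_delays.
have gt : gst a <= t by apply: le_trans Tt.
have gt' : gst a <= t + delta by lra_delays.
have [s [c [sc cv _]]] := in_v_history cp Tt' tT.
have rp := sent_received cp gt (sp p).
case: (boolP (prepare_seen c)) => ps; last first.
  exfalso; have np outs st' := quiescent (outs := outs) (st' := st') cp gt'.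
  case: (EM (safe (cv_val y) oq (lockedQC c))) => sf.
    apply: np; apply: (Quad_core _ _ _ sc).
    by apply: (@Replica_prepare _ _ _ _ _ _ y oq (vote_out p VPrepare (cur c) y)) => //; rewrite cv.
  apply: np; apply: (Quad_core _ _ _ sc).
  by apply: (@Replica_prepare _ _ _ _ _ _ y oq [::]) => //; rewrite cv.
have [j [jN [s1 [c1 [z [oz [sc1 cv1 rz cz [vz sz]]]]]]]] := prepare_history cp sc ps.
rewrite cv in cv1 rz sz; exists z; split=> //; apply: sz.
exact: leader_safe cp sc1 cv1 rz.
Qed.

Lemma leader_announces t X : T <= t -> t + delta <= T + 8 * delta ->
  (forall p, correct a p -> exists y, certified y /\ sent a (steps_until a t) p l
     (Vote X v y (vote_sig p X (cv_val y) v))) ->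
  exists q, [/\ valid_qc X q, qc_view q = v &
    forall d, sent a (steps_until a (t + delta)) l d (announce f X q)].
Proof.
move=> Tt tT votes; have Tt' : T <= t + delta by lra_delays.
have gt : gst a <= t by apply: le_trans Tt.
have gt' : gst a <= t + delta by lra_delays.
have [s [c [sc cv [_ _ N _]]]] := in_v_history correct_leader Tt' tT.
case: (boolP (X \in announced c)) => [/N|nX]; first by rewrite cv.
have [x xE] : exists x, forall p y, correct a p -> sent a (steps_until a t) p l
    (Vote X v y (vote_sig p X (cv_val y) v)) -> cv_val y = x.
  have [y [_ [k [ky sy]]]] := votes _ correct_leader; exists (cv_val y) => p z cp [j [jz sz]].
  have pz : produced_before a (steps_until a t) (vote_sig p X (cv_val z) v).
    by exists j, l; eexists; split; [exact: jz | exact: sz | left].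
  have py : produced_before a (steps_until a t) (vote_sig l X (cv_val y) v).
    by exists k, l; eexists; split; [exact: ky | exact: sy | left].
  exact: votes_agree cp correct_leader pz py.
have [cert Hc] : {cert : proc -> tsig & forall p, correct a p ->
    verify x (cert p) /\ received (at_time (t + delta) l) p
      (Vote X v (CVal x (cert p)) (vote_sig p X x v))}.
  apply: (@choice _ _ (fun p ct => correct a p -> verify x ct /\
     received (at_time (t + delta) l) p (Vote X v (CVal x ct) (vote_sig p X x v)))) => p.
  case: (boolP (correct a p)) => cp; last by exists (TSig FPlusOne (CAny V)).
  have [[y ct] [cy sy]] := votes p cp; exists ct => _.
  have yx := xE _ _ cp sy; rewrite /= in yx; subst y; split=> //.
  exact: sent_received correct_leader gt sy.
exfalso; apply: (quiescent (p := l) correct_leader gt').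
apply: (Quad_core _ _ _ sc).
apply: (@Leader_announce _ _ _ _ _ _ X x cert (~: byz a) l) => //.
- by rewrite cv.
- by have := cardsC (byz a); have := byz_bound a; rewrite card_ord /nproc; clear; lia.
- by move=> q; rewrite inE => cq; rewrite cv; apply: Hc.
- by rewrite inE.
Qed.

Lemma precommit_votes t q : T <= t -> t + delta <= T + 8 * delta ->
  valid_qc VPrepare q -> qc_view q = v ->
  (forall d, sent a (steps_until a t) l d (Precommit f q)) ->
  forall p, correct a p -> exists y, certified y /\
    sent a (steps_until a (t + delta)) p l
      (Vote VPrecommit v y (vote_sig p VPrecommit (cv_val y) v)).
Proof.
move=> Tt tT vq qv sq p cp; have Tt' : T <= t + delta by lra_delays.
have gt : gst a <= t by apply: le_trans Tt.
have gt' : gst a <= t + delta by lra_delays.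
have [s [c [sc cv [_ _ _ O]]]] := in_v_history cp Tt' tT.
case: (boolP (VPrecommit \in voted c)) => [/O|nX]; first by rewrite cv.
have rq := sent_received cp gt (sq p).
exfalso; apply: (quiescent cp gt'); apply: (Quad_core _ _ _ sc).
by apply: (@Replica_precommit _ _ _ _ _ _ q) => //; rewrite cv.
Qed.

Lemma commit_votes t q : T <= t -> t + delta <= T + 8 * delta ->
  valid_qc VPrecommit q -> qc_view q = v ->
  (forall d, sent a (steps_until a t) l d (Commit f q)) ->
  forall p, correct a p -> exists y, certified y /\
    sent a (steps_until a (t + delta)) p l
      (Vote VCommit v y (vote_sig p VCommit (cv_val y) v)).
Proof.
move=> Tt tT vq qv sq p cp; have Tt' : T <= t + delta by lra_delays.
have gt : gst a <= t by apply: le_trans Tt.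
have gt' : gst a <= t + delta by lra_delays.
have [s [c [sc cv [_ _ _ O]]]] := in_v_history cp Tt' tT.
case: (boolP (VCommit \in voted c)) => [/O|nX]; first by rewrite cv.
have rq := sent_received cp gt (sq p).
exfalso; apply: (quiescent cp gt'); apply: (Quad_core _ _ _ sc).
by apply: (@Replica_commit _ _ _ _ _ _ q) => //; rewrite cv.
Qed.

Lemma replicas_decide t q p : T <= t -> t + delta <= T + 8 * delta ->
  valid_qc VCommit q -> qc_view q = v ->
  (forall d, sent a (steps_until a t) l d (Decide f q)) ->
  correct a p -> decided (at_time (t + delta) p) <> None.
Proof.
move=> Tt tT vq qv sq cp; have Tt' : T <= t + delta by lra_delays.
have gt : gst a <= t by apply: le_trans Tt.
have gt' : gst a <= t + delta by lra_delays.
have [s [c [sc cv _]]] := in_v_history cp Tt' tT.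
rewrite /decided sc => dN.
have rq := sent_received cp gt (sq p).
apply: (quiescent cp gt'); apply: (Quad_core _ _ _ sc).
by apply: (@Replica_decide _ _ _ _ _ _ q) => //; rewrite cv.
Qed.

Lemma all_decide p : correct a p -> decided (at_time (T + 8 * delta) p) <> None.
Proof.
move=> cp; have tE (t : R) (k : nat) : T + k%:R * delta + delta = T + k.+1%:R * delta.
  by rewrite -natr1; ring.
have T0 k : T <= T + k%:R * delta by rewrite lerDl mulr_ge0 ?ler0n ?ltW.
have T8 k : (k < 8)%N -> T + k%:R * delta + delta <= T + 8 * delta.
  by move=> k8; rewrite tE // lerD2l ler_pM2r // ler_nat.
(* After the rewriting by [tE], each of [s1] to [s7] says what has been sent by [T + k * delta],
   where [k] is its number. *)
have [y [oq [cy vo s1]]] := leader_proposes (T0 0%N) (T8 0%N isT).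
rewrite tE // in s1.
have s2 p' cp' := replicas_vote (p := p') cp' (T0 1%N) (T8 1%N isT) cy vo s1.
rewrite tE // in s2.
have [q3 [vq3 qv3 s3]] := leader_announces (T0 2) (T8 2 isT) s2.
rewrite tE // in s3.
have s4 := precommit_votes (T0 3) (T8 3 isT) vq3 qv3 s3.
rewrite tE // in s4.
have [q5 [vq5 qv5 s5]] := leader_announces (T0 4) (T8 4 isT) s4.
rewrite tE // in s5.
have s6 := commit_votes (T0 5) (T8 5 isT) vq5 qv5 s5.
rewrite tE // in s6.
have [q7 [vq7 qv7 s7]] := leader_announces (T0 6) (T8 6 isT) s6.
rewrite tE // in s7.
have := replicas_decide (T0 7) (T8 7 isT) vq7 qv7 s7 cp.
by rewrite tE.
Qed.

End View.

End Decision.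

(** * Message counts *)

Local Notation n := (nproc f).

Lemma sum_unique_le1 (b : nat -> bool) m k :
  (forall i j, (m <= i < k)%N -> (m <= j < k)%N -> b i -> b j -> i = j) ->
  (\sum_(m <= i < k) b i <= 1)%N.
Proof.
elim: k => [|k IH] H; first by rewrite big_geq.
case: (leqP m k) => mk; last by rewrite big_geq.
rewrite big_nat_recr //=; case: (boolP (b k)) => bk; last first.
  by rewrite addn0; apply: IH => i j hi hj; apply: H; lia.
rewrite big1_seq // => i; rewrite mem_index_iota => /andP[_ hi].
by case: (boolP (b i)) => // bi; have := H i k; rewrite bi bk; lia.
Qed.

Lemma telescope_le (c phi : nat -> nat) l r : (l <= r)%N ->
  (forall i, (l <= i < r)%N -> (c i + phi i.+1 <= phi i)%N) ->
  (\sum_(l <= i < r) c i + phi r <= phi l)%N.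
Proof.
elim: r => [|r IH]; first by rewrite leqn0 => /eqP -> _; rewrite big_geq.
rewrite leq_eqVlt => /predU1P[-> _|]; first by rewrite big_geq.
rewrite ltnS => lr H; rewrite big_nat_recr //=.
have H1 : (c r + phi r.+1 <= phi r)%N by apply: H; rewrite lr ltnSn.
have H2 : (\sum_(l <= i < r) c i + phi r <= phi l)%N.
  by apply: IH => // i hi; apply: H; lia.
by lia.
Qed.

(** The largest message is PREPARE with a QC: three threshold signatures and two values, at worst
    one per word. *)
Lemma words_le w (m : msg) : (0 < w)%N -> (words w m <= 5)%N.
Proof.
move=> w0; rewrite /words; set k := (size _ + size _ + size _)%N.
have k5 : (k <= 5)%N.
  by rewrite /k; case: m {k} => [x s|s|[x|] c|e s|e [s|]|v [q|]|v x [q|]|T v x s|q|q|q].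
by rewrite geq_max /=; rewrite -ltnS ltn_divLR //; lia.
Qed.

(** Messages that [p] may still send in the current view. The VIEW-CHANGE message is absent, since
    it is sent on entering the view and charged to the timer that has expired. *)
Definition core_budget (p : proc) (c : core_state) : nat :=
  ((~~ prepare_seen c) + (VPrecommit \notin voted c) + (VCommit \notin voted c) +
   (p == leader f (cur c)) *
   (n * (~~ proposed c) + n * (VPrepare \notin announced c) +
    n * (VPrecommit \notin announced c) + n * (VCommit \notin announced c)))%N.

Lemma core_budget_le p c : (core_budget p c <= 3 + 4 * n)%N.
Proof.
rewrite /core_budget; case: (p == _); last by clear; lia.
by case: (proposed c); do 3 case: (_ \in announced c) => /=; clear; lia.
Qed.

Lemma core_budget_advance p v c :
  core_budget p (advance v c) = (3 + 4 * (n * (p == leader f v)))%N.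
Proof. by rewrite /core_budget /=; case: (_ == _) => /=; lia. Qed.

Lemma core_step_cost p (st : lstate) c outs c' : core_step p st c outs c' ->
  (size outs + core_budget p c' <= core_budget p c)%N.
Proof.
case=> {c outs c'} /=.
- move=> c Q qcs h pl np _ _ _ _; rewrite size_broadcast /core_budget /= np -pl eqxx.
  by rewrite muln1 muln0; lia.
- move=> c y oq outs ps _ _ _ sf usf; rewrite /core_budget /= ps.
  case: (EM (safe (cv_val y) oq (lockedQC c))) => [/sf|/usf] -> /=; lia.
- move=> c T y cert Q h pl nT _ _ _; rewrite size_broadcast /core_budget /= -pl eqxx !inE.
  by case: T nT => /= ->; rewrite muln1 muln0; lia.
- by move=> c q nv _ _ _; rewrite /core_budget /= !inE /= nv; lia.
- by move=> c q nv _ _ _; rewrite /core_budget /= !inE /= nv; lia.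
- by [].
Qed.

Definition pending (L : R) (timer : option R) : bool :=
  if timer is Some d then d <= L else false.

Arguments pending : simpl never.

(* [L] is a reading of the local clock, before which no timer that is set from
   now on can expire. *)
Definition slab_budget (p : proc) (L : R) (st : lstate) : nat :=
  (n * (~~ started st) +
   if quad st is Some (s, c) then
     core_budget p c +
     (5 * n + 4) * (pending L (view_timer s) + pending L (dissemination_timer s))
   else n * (~~ allow_any_sent st) + (5 * n + 4))%N.

(** The worst case is [n + (3 + 4 * n) + 2 * (5 * n + 4) = 15 * n + 11], and [n] is at least 1. *)
Lemma slab_budget_le p L st : (slab_budget p L st <= 26 * n)%N.
Proof.
rewrite /slab_budget; have n0 : (0 < n)%N by [].
case: (quad st) => [[s c]|].
  have := core_budget_le p c.
  by case: (started st); case: (pending _ _); case: (pending _ _) => /=; lia.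
by case: (started st); case: (allow_any_sent st) => /=; lia.
Qed.

Lemma expired_pending clk L timer : clk <= L -> expired timer clk -> pending L timer.
Proof. by case: timer => //= d cL /le_trans; apply. Qed.

Lemma pending_None L : pending L None = false.
Proof. by []. Qed.

(** An expiration pays [5 * n + 4]: a broadcast, a VIEW-CHANGE message and a fresh [core_budget] of
    at most [3 + 4 * n]; the exit from certification costs the same. A timer set now is due after
    [L], so it adds nothing to the budget. *)
Lemma slab_step x p clk inc (st st' : lstate) outs L :
  0 < delta -> 0 < eps -> clk <= L -> L < clk + delta ->
  pstep x p clk inc st outs st' ->
  (size outs + slab_budget p L st' <= slab_budget p L st)%N.
Proof.
move=> d0 e0 cL Ld; rewrite /slab_budget.
have newd : pending L (Some (clk + delta)) = false by apply/negbTE; rewrite /pending -ltNge.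
have newv : pending L (Some (clk + view_duration)) = false.
  apply/negbTE; rewrite /pending -ltNge; apply: lt_le_trans Ld _.
  by rewrite lerD2l /Defs.view_duration /Delta; lra.
case=> {outs st'}.
- by [].
- by [].
- by move=> /= ->; rewrite size_broadcast; lia.
- by move=> /= -> -> -> _ _; rewrite size_broadcast; lia.
- move=> ox c y sst qN _ _ core /=; rewrite sst qN size_cat size_broadcast.
  rewrite core_budget_advance newv ?pending_None /=; case: (_ == _) => /=; lia.
- move=> s c s' c' outs sst -> H; inversion H; subst; rewrite /= sst.
  + rewrite newv ?pending_None core_budget_advance (expired_pending (timer := view_timer s) cL) //=.
    by case: (_ == _); lia.
  + by rewrite ?pending_None size_broadcast (expired_pending (timer := view_timer s) cL) //=; lia.
  + by rewrite newd ?pending_None; lia.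
  + by rewrite newd ?pending_None; lia.
  + rewrite newv ?pending_None core_budget_advance size_cat size_broadcast /=.
    by rewrite (expired_pending (timer := dissemination_timer s) cL) //=; case: (_ == _); lia.
- by move=> s c c' outs sst -> /core_step_cost /=; rewrite sst; lia.
Qed.

(* Per view, a VIEW-CHANGE message, at most three votes and, from the leader, at
   most four broadcasts; the last term is for EPOCH-COMPLETED. *)
Definition views_budget (p : proc) (e k : nat) : nat :=
  (\sum_(k <= j < f.+2) (4 + 4 * (n * (p == leader f (gv e j)))) + n)%N.

(** ENTER-EPOCH and EPOCH-COMPLETED take [2 * n], the at most one view led by [p] takes [4 * n], and
    the rest is [4 * f.+1 <= 4 * n]. *)
Lemma views_budget_le p e : (0 < e)%N -> (n + views_budget p e 1 <= 10 * n)%N.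
Proof.
move=> e0; rewrite /views_budget big_split /= sum_nat_const_nat -!big_distrr /=.
have : (\sum_(1 <= j < f.+2) (p == leader f (gv e j)) <= 1)%N.
  apply: sum_unique_le1 => i j hi hj /eqP -> /eqP E.
  by apply: leader_inj E; lia.
by rewrite /nproc; move: (\sum_(_ <= _ < _) _)%N => S; nia.
Qed.

(** What is left of the current view is in [core_budget], so the sum starts at [(view s).+1]. With
    both timers off the synchronizer stays silent until a new epoch. *)
Definition epoch_budget (p : proc) (s : sync_state) : nat :=
  if dissemination_timer s is Some _ then (n + views_budget p (epoch s) 1)%N
  else if view_timer s is Some _ then views_budget p (epoch s) (view s).+1 else 0%N.

Definition epochs_budget (p : proc) (E : nat) (st : lstate) : nat :=
  if quad st is Some (s, c) then
    (core_budget p c + (E - epoch s) * (10 * n) + epoch_budget p s)%N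
  else 0%N.

Lemma views_budget_recl p e k : (k <= f.+1)%N -> views_budget p e k =
  (4 + 4 * (n * (p == leader f (gv e k))) + views_budget p e k.+1)%N.
Proof. by move=> kf; rewrite /views_budget big_ltn ?ltnS // -addnA. Qed.

Lemma epoch_budget_le p s v : wf_sync s v -> (epoch_budget p s <= 10 * n)%N.
Proof.
case=> e0 v0 _ _ _; have := views_budget_le p e0; rewrite /epoch_budget.
case: (dissemination_timer s) => //; case: (view_timer s) => // d.
have : (views_budget p (epoch s) (view s).+1 <= views_budget p (epoch s) 1)%N.
  rewrite /views_budget leq_add2r [leqRHS](@big_cat_nat _ _ _ (view s).+1) //=; last lia.
  exact: leq_addl.
by lia.
Qed.

Lemma epochs_step x p clk inc (st st' : lstate) outs E : wf st ->
  quad st <> None -> pstep x p clk inc st outs st' ->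
  (epoch_of st' <= E)%N ->
  (size outs + epochs_budget p E st' <= epochs_budget p E st)%N.
Proof.
rewrite /epochs_budget /epoch_of => w qS; case=> {outs st'} //.
- move=> nst; move: w; rewrite /wf; case E1: (quad st) qS => [[s c]|] // _.
  by rewrite (negPf nst) => -[].
- move=> s c s' c' outs sst sc H; move: w; rewrite /wf sc => -[_ ws _] /=.
  have [e0 v0 N S G] := ws; inversion H; subst => /= eE.
  + have ex : expired (view_timer s) clk by [].
    have dN : dissemination_timer s = None.
      by case: (dissemination_timer s) S => // d [] // vN; rewrite vN in ex.
    rewrite /epoch_budget /= dN; case: (view_timer s) ex => // d _.
    rewrite (views_budget_recl p (epoch s) (k := (view s).+1)); last by [].
    by rewrite core_budget_advance /v; lia.
  + have ex : expired (view_timer s) clk by [].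
    have dN : dissemination_timer s = None.
      by case: (dissemination_timer s) S => // d [] // vN; rewrite vN in ex.
    rewrite /epoch_budget /= dN; case: (view_timer s) ex => // d _.
    by rewrite size_broadcast /views_budget; lia.
  + have := views_budget_le p (ltn0Sn e); rewrite /epoch_budget /=.
    have ee : (epoch s <= e)%N by [].
    have : ((E - e.+1) * (10 * n) + 10 * n <= (E - epoch s) * (10 * n))%N.
      by rewrite -mulSnr leq_mul2r; apply/orP; right; lia.
    by lia.
  + have ee : (epoch s < e)%N by [].
    have := views_budget_le p (leq_ltn_trans (leq0n _) ee); rewrite /epoch_budget /=.
    have : ((E - e) * (10 * n) + 10 * n <= (E - epoch s) * (10 * n))%N.
      by rewrite -mulSnr leq_mul2r; apply/orP; right; lia.
    by lia.
  + have ex : expired (dissemination_timer s) clk by [].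
    rewrite /epoch_budget /=; case: (dissemination_timer s) ex => // d _.
    rewrite (views_budget_recl p (epoch s) (k := 1)) //.
    by rewrite core_budget_advance size_cat size_broadcast /v /=; lia.
- by move=> s c c' outs _ sc /core_step_cost /= H eE; rewrite sc; lia.
Qed.

Section Budgets.

Variable a : execution.

Local Notation at_time := (at_time a).

Definition cost (p : proc) (i : nat) : nat := size (outs_of a i p).

Lemma words_sent_le w i : (0 < w)%N ->
  (words_sent w a i <= 5 * \sum_(p | correct a p) cost p i)%N.
Proof.
move=> w0; have := steps_valid a i; rewrite /words_sent /cost /outs_of /valid_step /sends.
case: (ev a i) => [_|q outs|b outs|j k _]; try by rewrite big_nil.
  case=> cq _ _; rewrite (bigD1 q) //= outs_of_map eqxx big_map mulnDr.
  apply: leq_trans (leq_addr _ _).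
  rewrite mulnC -sum1_size big_distrl /= big_mkcond /=.
  by apply: leq_sum => o _; rewrite mul1n; case: ifP => // _; apply: words_le.
by case=> cb _ _; rewrite big_map big_mkcond big1 //= => o _; rewrite (negPf cb).
Qed.

Lemma slab_cost p l r u : correct a p -> (l <= r)%N ->
  (forall i, (l <= i < r)%N ->
     [/\ gst a <= time a i, time a i <= u & u < time a i + delta]) ->
  (\sum_(l <= i < r) cost p i <= 26 * n)%N.
Proof.
move=> cp lr H.
apply: leq_trans (slab_budget_le p (clock a p u) (conf a l p)).
apply: leq_trans (telescope_le (phi := fun i => slab_budget p (clock a p u) (conf a i p)) lr _).
  exact: leq_addr.
move=> i /H [gi iu ui]; apply: slab_step (executionP i cp) => //.
  exact: clock_monotone.
have -> : u = time a i + (u - time a i) by ring.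
by rewrite clockD //; lra.
Qed.

Lemma slab_cost_after p t : correct a p -> gst a <= t ->
  (\sum_(steps_until a t <= i < steps_until a (t + delta)) cost p i <= 26 * n)%N.
Proof.
move=> cp gt; apply: (slab_cost (u := t + delta)) => //.
  by apply: steps_until_mono; lra_delays.
move=> i /andP[]; rewrite leqNgt !ltn_steps_until -ltNge => ti iu.
by split=> //; lra_delays.
Qed.

Lemma slab_cost_4 p t : correct a p -> gst a <= t ->
  (\sum_(steps_until a t <= i < steps_until a (t + 4 * delta)) cost p i <= 104 * n)%N.
Proof.
move=> cp gt.
have E4 : t + 4 * delta = t + delta + delta + delta + delta by ring.
rewrite E4; set u1 := t + delta; set u2 := u1 + delta; set u3 := u2 + delta.
have g1 : gst a <= u1 by rewrite /u1; lra_delays.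
have g2 : gst a <= u2 by rewrite /u2; lra_delays.
have g3 : gst a <= u3 by rewrite /u3; lra_delays.
have S0 : (steps_until a t <= steps_until a u1)%N.
  by apply: steps_until_mono; rewrite /u1; lra_delays.
have S1 : (steps_until a u1 <= steps_until a u2)%N.
  by apply: steps_until_mono; rewrite /u2; lra_delays.
have S2 : (steps_until a u2 <= steps_until a u3)%N.
  by apply: steps_until_mono; rewrite /u3; lra_delays.
have S3 : (steps_until a u3 <= steps_until a (u3 + delta))%N.
  by apply: steps_until_mono; lra_delays.
have := slab_cost_after cp gt; have := slab_cost_after cp g1.
have := slab_cost_after cp g2; have := slab_cost_after cp g3.
rewrite -/u1 -/u2 -/u3 => H3 H2 H1 H0.
rewrite (big_cat_nat S0) /=; last by apply: leq_trans S1 (leq_trans S2 S3).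
rewrite (big_cat_nat S1) /=; last by apply: leq_trans S2 S3.
rewrite (big_cat_nat S2) //=.
move: H0 H1 H2 H3; clear; lia.
Qed.

Lemma epochs_cost p l r E : correct a p -> (l <= r)%N ->
  quad (conf a l p) <> None -> (epoch_of (conf a r p) <= E)%N ->
  (\sum_(l <= i < r) cost p i <= epochs_budget p E (conf a l p))%N.
Proof.
move=> cp lr ql er.
apply: leq_trans (telescope_le (phi := fun i => epochs_budget p E (conf a i p)) lr _).
  exact: leq_addr.
move=> i /andP[li ir]; apply: epochs_step (conf_wf i cp) _ (executionP i cp) _.
  case ql': (quad (conf a l p)) ql => [[s c]|//] _.
  by have [s' [c' [->]]] := quad_some cp li ql'.
exact: leq_trans (epoch_of_mono cp ir) er.
Qed.

(* A process runs through old epochs only during the first [4 delta] after GST.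
   It sends at most [26 n] messages while each timer expires at most once: this
   holds at GST itself, then in four slabs of length [delta]. Two epochs remain,
   of [10 n] messages each, besides the [7 n] of the view in progress. *)
Lemma process_cost p l E D : correct a p ->
  (forall i, (l <= i)%N = (gst a <= time a i)) ->
  gst a + 4 * delta <= D -> (epoch_of (at_time D p) <= E)%N ->
  (exists s c, quad (at_time (gst a + 4 * delta) p) = Some (s, c) /\
     (E <= (epoch s).+1)%N) ->
  (\sum_(l <= i < steps_until a D) cost p i <= 157 * n)%N.
Proof.
move=> cp lE gD eD [s [c [sc Es]]].
have n0 : (0 < n)%N by [].
have S0 : (l <= steps_until a (gst a))%N.
  by rewrite lE ltW // steps_until_gt.
have S1 : (steps_until a (gst a) <= steps_until a (gst a + 4 * delta))%N.
  by apply: steps_until_mono; lra_delays.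
have S2 : (steps_until a (gst a + 4 * delta) <= steps_until a D)%N.
  exact: steps_until_mono.
have H0 : (\sum_(l <= i < steps_until a (gst a)) cost p i <= 26 * n)%N.
  apply: (slab_cost (u := gst a)) => // i /andP[]; rewrite lE ltn_steps_until => gi ig.
  by split=> //; lra_delays.
have H1 := slab_cost_4 cp (lexx (gst a)).
have H2 : (\sum_(steps_until a (gst a + 4 * delta) <= i < steps_until a D) cost p i <=
    epochs_budget p E (at_time (gst a + 4 * delta) p))%N.
  by apply: epochs_cost => //; rewrite -/(at_time _ _) sc.
have H3 : (epochs_budget p E (at_time (gst a + 4 * delta) p) <= 27 * n)%N.
  rewrite /epochs_budget sc; have [_ ws _] := conf_wfP cp sc.
  have := epoch_budget_le p ws; have := core_budget_le p c.
  have : ((E - epoch s) * (10 * n) <= 1 * (10 * n))%N.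
    by rewrite leq_mul2r; apply/orP; right; rewrite leq_subLR addn1.
  by clear -n0; lia.
rewrite (big_cat_nat S0) /=; last exact: leq_trans S1 S2.
rewrite (big_cat_nat S1) //=.
by move: H0 H1 H2 H3; clear; lia.
Qed.

(** At most [n] correct processes send at most [157 * n] messages each, of at most 5 words. Counting
    up to [D] instead of [td] only adds messages. *)
Lemma communication_le w td E D : (0 < w)%N -> td <= D ->
  gst a + 4 * delta <= D ->
  (forall p, correct a p -> (epoch_of (at_time D p) <= E)%N) ->
  (forall p, correct a p -> exists s c,
     quad (at_time (gst a + 4 * delta) p) = Some (s, c) /\ (E <= (epoch s).+1)%N) ->
  (communication w a td <= 785 * n ^ 2)%N.
Proof.
move=> w0 tdD gD eD HE; rewrite /communication.
have [l lE] : exists l, forall i, (l <= i)%N = (gst a <= time a i).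
  have ex : exists i, gst a <= time a i.
    by have [i /ltW] := time_unbounded a (gst a); exists i.
  case: (ex_minnP ex) => l gl lmin; exists l => i.
  by apply/idP/idP => [/(time_mono a)|/lmin //]; apply: le_trans.
have SD := steps_until_mono a tdD.
pose F i := (\sum_(p | correct a p) cost p i)%N.
apply: (@leq_trans (\sum_(l <= i < steps_until a D) 5 * F i)).
  rewrite -(big_mkord (fun i => gst a <= time a i) (words_sent w a)).
  apply: (@leq_trans (\sum_(0 <= i < steps_until a D | gst a <= time a i) words_sent w a i)).
    rewrite [leqRHS](@big_cat_nat _ _ _ (steps_until a td)) //=.
    exact: leq_addr.
  case: (leqP l (steps_until a D)) => lD; last first.
    rewrite big_nat_cond big1 // => i /andP[/andP[_ iD]].
    by rewrite -lE leqNgt (ltn_trans iD lD).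
  rewrite (@big_cat_nat _ _ _ l) //= big_nat_cond big1 ?add0n; last first.
    by move=> i /andP[/andP[_ il]]; rewrite -lE leqNgt il.
  rewrite big_mkcond /=; apply: leq_sum => i _; case: ifP => // _.
  exact: words_sent_le.
rewrite -big_distrr /= /F exchange_big /=.
apply: (@leq_trans (5 * \sum_(p | correct a p) 157 * n)).
  rewrite leq_mul2l /=; apply: leq_sum => p cp.
  exact: process_cost cp lE gD (eD p cp) (HE p cp).
rewrite sum_nat_const.
have : (#|[pred p | correct a p]| <= n)%N by apply: leq_trans (max_card _) _; rewrite card_ord.
by rewrite -mulnn; move: #|_| => k; nia.
Qed.

End Budgets.

(** * Decision time and the two bounds *)

Section Complexity.

Variable a : execution.

Local Notation at_time := (at_time a).

Lemma decision_bound : exists E D,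
  [/\ gst a + 4 * delta <= D,
    D <= gst a + 15 * delta + (2 * f.+1)%:R * view_duration,
    forall p, correct a p -> decided (at_time D p) <> None,
    forall p, correct a p -> (epoch_of (at_time D p) <= E)%N &
    forall p, correct a p -> exists s c,
      quad (at_time (gst a + 4 * delta) p) = Some (s, c) /\ (E <= (epoch s).+1)%N].
Proof.
have [E [v [T [cl gT TD in_v [eE HE]]]]] := synchronization a.
exists E, (T + 8 * delta); split=> //; first by lra_delays.
  by move=> p cp; apply: all_decide in_v _ cp.
by move=> p cp; apply: eE.
Qed.

Lemma decided_conf D p : correct a p -> gst a <= D ->
  decided (at_time D p) <> None ->
  exists i, time a i <= D /\ decided (conf a i.+1 p) <> None.
Proof.
move=> cp gD; rewrite /at_time => dp; have N0 := steps_until_gt0 cp gD.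
exists (steps_until a D).-1; rewrite prednK //; split=> //.
exact: time_last_step cp gD.
Qed.

Lemma execution_termination : termination a.
Proof.
have [E [D [_ _ dD _ _]]] := decision_bound => p /dD.
case dx: (decided _) => [x|//] _; exists x.
by exists (steps_until a D).
Qed.

(** The least time is attained: it is the time of the latest among the first deciding steps of the
    finitely many correct processes. *)
Lemma decision_time_exists D : gst a <= D ->
  (forall p, correct a p -> decided (at_time D p) <> None) ->
  exists td, decision_time a td /\ td <= D.
Proof.
move=> gD dD.
pose dec p i := isSome (decided (conf a i.+1 p)).
have [g Hg] : {g : proc -> nat & forall p, correct a p ->
    [/\ dec p (g p), time a (g p) <= D & forall j, dec p j -> (g p <= j)%N]}.
  apply: (@choice _ _ (fun p i => correct a p -> [/\ dec p i, time a i <= D &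
    forall j, dec p j -> (i <= j)%N])) => p.
  case: (boolP (correct a p)) => cp; last by exists 0%N.
  have [i [iD di]] := decided_conf cp gD (dD p cp).
  have ex : exists i, dec p i by exists i; rewrite /dec; case: (decided _) di.
  case: (ex_minnP ex) => k dk kmin; exists k => _; split=> //.
  apply: le_trans iD; apply: time_mono; apply: kmin.
  by rewrite /dec; case: (decided _) di.
have [p0 cp0] := exists_correct a.
have [|q cq Eq] := @eq_bigmax_cond _ (correct a) g.
  by apply/card_gt0P; exists p0.
have [dq qD qmin] := Hg q cq; exists (time a (g q)); split=> //; split.
  move=> p cp; have [dp _ _] := Hg p cp; exists (g p).
  move: dp; rewrite /dec; case dx: (decided _) => [x|//] _; exists x; split=> //.
  by apply: time_mono; rewrite -Eq; apply: (@leq_bigmax_cond _ (correct a) g).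
move=> t /(_ q cq) [i [x [it dx]]]; apply: le_trans it; apply: time_mono.
by apply: qmin; rewrite /dec dx.
Qed.

Lemma execution_complexity w : (0 < f)%N -> (0 < w)%N ->
  exists td, [/\ decision_time a td,
    (communication w a td)%:R <= 785%:R * (nproc f)%:R ^+ 2 :> R &
    latency a td <= (15%:R * delta + 4%:R * view_duration) * f%:R].
Proof.
move=> f0 w0; have [E [D [gD Db dD eE HE]]] := decision_bound.
have gD' : gst a <= D by lra_delays.
have [td [dt tD]] := decision_time_exists gD' dD.
exists td; split=> //.
  rewrite -natrX -natrM ler_nat.
  exact: (communication_le w0 tD gD eE HE).
have vd0 := vd_gt0.
have f1 : 1 <= f%:R :> R by rewrite ler1n.
have E1 : (2 * f.+1)%:R = 2 * f%:R + 2 :> R by rewrite natrM -natr1; ring.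
rewrite E1 in Db.
(* As [1 <= f], the part of the bound that is constant in [f], [15 * delta + 2 * view_duration], is
   at most [f] times itself. *)
have le1 : 0 <= (15 * delta + 2 * view_duration) * (f%:R - 1).
  by apply: mulr_ge0; lra_delays.
rewrite /latency ge_max; apply/andP; split.
  by apply: mulr_ge0; lra_delays.
by lra.
Qed.

End Complexity.

End SQuad.

Theorem theorem4 (R : realType) (delta eps : R) (w : nat) :
  0 < delta -> 0 < eps -> (0 < w)%N ->
  (forall (V : Type) (f : nat) (a : execution V f delta eps), (0 < f)%N ->
     [/\ validity a, agreement a & termination a]) /\
  (exists C : R, forall (V : Type) (f : nat) (a : execution V f delta eps),
     (0 < f)%N ->
     exists td, decision_time a td /\
       (communication w a td)%:R <= C * (nproc f)%:R ^+ 2) /\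
  (exists C : R, forall (V : Type) (f : nat) (a : execution V f delta eps),
     (0 < f)%N ->
     exists td, decision_time a td /\ latency a td <= C * f%:R).
Proof.
move=> delta_gt0 eps_gt0 w_gt0; split; last split.
- move=> V f a _; split; first exact: execution_validity.
    exact: execution_agreement.
  exact: execution_termination.
- exists 785%:R => V f a f_gt0.
  have [td [dt comm _]] := execution_complexity delta_gt0 eps_gt0 a f_gt0 w_gt0.
  by exists td.
- exists (15%:R * delta + 4%:R * view_duration delta eps) => V f a f_gt0.
  have [td [dt _ lat]] := execution_complexity delta_gt0 eps_gt0 a f_gt0 w_gt0.
  by exists td.
Qed.
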